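(* Let $0<a<b$, and consider the continuous time linear regression model $$\mathbf{Y}(t)=\begin{pmatrix}Y_1(t)\\ Y_2(t)\end{pmatrix}=\mathbf{F}^\top(t)\theta+\mathbf{\Sigma}^{1/2}\boldsymbol{\varepsilon}(t),\qquad t\in[a,b],$$ where $\theta\in\mathbb{R}^p$ is an unknown parameter, $\mathbf{F}$ is a continuously differentiable $(p\times 2)$-matrix valued function on $[a,b]$, $\boldsymbol{\varepsilon}=(\varepsilon_1,\varepsilon_2)^\top$ is a vector of two independent Brownian motions on $[a,b]$, and $\mathbf{\Sigma}=\begin{pmatrix}\sigma_1^2&\sigma_1\sigma_2\varrho\\ \sigma_1\sigma_2\varrho&\sigma_2^2\end{pmatrix}$ with $\sigma_1,\sigma_2>0$, $\varrho\in(-1,1)$. Assume that the $(p\times p)$-matrix $$\mathbf{M}=\int_a^b\dot{\mathbf{F}}(t)\mathbf{\Sigma}^{-1}\dot{\mathbf{F}}^\top(t)\,dt+\frac1a\mathbf{F}(a)\mathbf{\Sigma}^{-1}\mathbf{F}^\top(a)$$ is non-singular. Then the best linear unbiased estimator of $\theta$ is given by $$\hat\theta_{\rm BLUE}=\mathbf{M}^{-1}\Big(\int_a^b\dot{\mathbf{F}}(t)\mathbf{\Sigma}^{-1}\,d\mathbf{Y}(t)+\frac1a\mathbf{F}(a)\mathbf{\Sigma}^{-1}\mathbf{Y}(a)\Big),$$ and the minimum variance is given by $$\mathrm{Cov}(\hat\theta_{\rm BLUE})=\mathbf{M}^{-1}=\Big(\int_a^b\dot{\mathbf{F}}(t)\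mathbf{\Sigma}^{-1}\dot{\mathbf{F}}^\top(t)\,dt+\frac1a\mathbf{F}(a)\mathbf{\Sigma}^{-1}\mathbf{F}^\top(a)\Big)^{-1}.$$
   Context: The full trajectory $\{\mathbf{Y}(t): t\in[a,b]\}$ is observed. The Brownian motions on $[a,b]$ are centered continuous Gaussian processes with $\mathbb{E}[\varepsilon_i(s)\varepsilon_i(t)]=\min(s,t)$ (in particular $\varepsilon_i(a)\sim\mathcal{N}(0,a)$). $\mathbf{\Sigma}^{1/2}$ is the (symmetric) square root of $\mathbf{\Sigma}$. A dot denotes differentiation with respect to $t$. The $p$ two-dimensional functions forming the columns of $\mathbf{F}^\top$ are assumed to be linearly independent. A linear estimator of $\theta$ is one of the form $\int_a^b\mathbf{G}(t)\,d\mathbf{Y}(t)+\mathbf{C}\,\mathbf{Y}(a)$ with a deterministic square integrable $(p\times2)$-matrix function $\mathbf{G}$ and a deterministic $(p\times 2)$-matrix $\mathbf{C}$; it is unbiased if its expectation is $\theta$ for every $\theta\in\mathbb{R}^p$. The best linear unbiased estimator (BLUE) is the linear unbiased estimator whose covariance matrix is minimal with respect to the Loewner ordering ($A\le B$ iff $B-A$ is nonnegative definite) among all linear unbiased estimators. *)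

(* Defs.v *)
From HB Require Import structures.
From mathcomp Require Import all_boot all_order all_algebra.
From mathcomp Require Import all_classical all_reals all_analysis.

Set Implicit Arguments.
Unset Strict Implicit.
Unset Printing Implicit Defensive.

Import Order.TTheory GRing.Theory Num.Theory.
Import numFieldNormedType.Exports.

Local Open Scope classical_set_scope.
Local Open Scope ring_scope.

Section matrices.
Context {R : realType}.

Definition nonneg_definite n (A : 'M[R]_n) : Prop :=
  A^T = A /\ forall x : 'cV[R]_n, 0 <= (x^T *m A *m x) 0 0.

Definition loewner_le n (A B : 'M[R]_n) : Prop := nonneg_definite (B - A).

(* Determines S uniquely when A is symmetric and nonnegative definite. *)
Definition is_sqrt_mx n (A S : 'M[R]_n) : Prop :=
  nonneg_definite S /\ S *m S = A.

Definition Sigma_mx (s1 s2 rho : R) : 'M[R]_2 :=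
  \matrix_(i, j) if i == j then (if i == 0 then s1 ^+ 2 else s2 ^+ 2)
                 else s1 * s2 * rho.

End matrices.

Section calculus.
Context {R : realType}.

(* The limit is taken inside [a, b]; it is one-sided at a and b. *)
Definition derivative_on (a b : R) (f df : R -> R) : Prop :=
  forall t, t \in `[a, b] ->
    (s - t)^-1 * (f s - f t) @[s --> within [set` `[a, b]] t^'] --> df t.

Definition C1_on (a b : R) m n (F dF : R -> 'M[R]_(m, n)) : Prop :=
  forall i j,
    derivative_on a b (fun t => F t i j) (fun t => dF t i j) /\
    {within `[a, b], continuous (fun t => dF t i j)}.

Definition square_integrable (a b : R) (g : R -> R) : Prop :=
  measurable_fun `[a, b] g /\
  (\int[lebesgue_measure]_(t in `[a, b]) (g t ^+ 2)%:E < +oo)%E.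

Definition info_mx (a b : R) m n (F dF : R -> 'M[R]_(m, n)) (Sigma : 'M[R]_n) :
    'M[R]_m :=
  (\matrix_(i, j) \int[lebesgue_measure]_(t in `[a, b])
      (dF t *m invmx Sigma *m (dF t)^T) i j)
  + a^-1 *: (F a *m invmx Sigma *m (F a)^T).

(* The list element ((c, s), t) stands for c times the indicator of ]s, t]. *)
Definition step_on (a b : R) (q : seq (R * R * R)) : Prop :=
  forall e, e \in q -> [/\ a <= e.1.2, e.1.2 <= e.2 & e.2 <= b].

Definition step_fun (q : seq (R * R * R)) (x : R) : R :=
  \sum_(e <- q) e.1.1 * \1_(`]e.1.2, e.2]) x.

Definition step_integral T (q : seq (R * R * R)) (X : R -> T -> R) (w : T) : R :=
  \sum_(e <- q) e.1.1 * (X e.2 w - X e.1.2 w).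

End calculus.

Section processes.
Context d (T : measurableType d) {R : realType} (P : probability T R).

(* Constants are Gaussian (s = 0); the library's normal_prob m 0 is not a
   point mass, so this case is separate. *)
Definition gaussian_rv (X : T -> R) : Prop :=
  exists m s : R, forall A : set R, measurable A ->
    P (X @^-1` A) = if s == 0 then \d_m A else normal_prob m s A.

Definition gaussian_process_on (a b : R) (X : R -> {RV P >-> R}) : Prop :=
  forall n (t c : 'I_n -> R), (forall i, t i \in `[a, b]) ->
    gaussian_rv (fun w => \sum_i c i * X (t i) w).

(* When a > 0 this is the restriction to [a, b] of a Brownian motion started
   in 0 at time 0: X a is N(0, a). *)
Definition brownian_motion_on (a b : R) (X : R -> {RV P >-> R}) : Prop :=
  [/\ gaussian_process_on a b X,
      forall t, t \in `[a, b] -> ('E_P[X t] = 0)%E,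
      forall s t, s \in `[a, b] -> t \in `[a, b] ->
        'E_P[(X s \* X t)%R]%E = (Num.min s t)%:E
    & {ae P, forall w, {within `[a, b], continuous (fun t => X t w)}}].

Definition sigma_of_process_on (a b : R) (X : R -> {RV P >-> R}) :
    set (set T) :=
  <<s [set E | exists t, t \in `[a, b] /\
         exists2 A : set R, measurable A & E = X t @^-1` A] >>.

Definition independent_processes_on (a b : R) (X Y : R -> {RV P >-> R}) : Prop :=
  forall A B, sigma_of_process_on a b X A -> sigma_of_process_on a b Y B ->
    P (A `&` B) = (P A * P B)%E.

(* I is a version of the integral over [a, b] of the deterministic function g
   against the process X: the mean-square limit of the integrals of step
   functions that converge to g in L^2([a, b]). For the processes in the
   theorem the limit does not depend, almost surely, on the sequence. *)
Definition wiener_integral (a b : R) (g : R -> R) (X : R -> T -> R)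
    (I : T -> R) : Prop :=
  I \in Lfun P 2%:E /\
  exists q : nat -> seq (R * R * R),
    [/\ forall n, step_on a b (q n),
        (\int[lebesgue_measure]_(x in `[a, b])
          ((step_fun (q n) x - g x) ^+ 2)%:E)%E @[n --> \oo] --> 0%E
      & 'E_P[fun w => ((step_integral (q n) X w - I w) ^+ 2)%R]%E @[n --> \oo]
          --> 0%E].

Definition wiener_integral_mx (a b : R) m n (G : R -> 'M[R]_(m, n))
    (Y : R -> T -> 'cV[R]_n) (I : T -> 'cV[R]_m) : Prop :=
  exists J : 'I_m -> 'I_n -> T -> R,
    (forall i j, wiener_integral a b (fun t => G t i j)
                   (fun t w => Y t w j 0) (J i j)) /\
    forall w i, I w i 0 = \sum_j J i j w.

Definition cov_mx m (Z : T -> 'cV[R]_m) : 'M[R]_m :=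
  \matrix_(i, j) fine (covariance P (fun w => Z w i 0) (fun w => Z w j 0)).

Definition regression_process m (F : R -> 'M[R]_(m, 2)) (S : 'M[R]_2)
    (eps : 'I_2 -> R -> {RV P >-> R}) (theta : 'cV[R]_m) (t : R) (w : T) :
    'cV[R]_2 :=
  (F t)^T *m theta + S *m (\col_i eps i t w).

(* An estimator is represented by a family of random vectors: Z theta is its
   value when theta is the true parameter, that is, when the trajectory
   Y theta is observed. The coefficients G and C do not depend on theta. *)
Definition linear_estimator (a b : R) m
    (Y : 'cV[R]_m -> R -> T -> 'cV[R]_2) (Z : 'cV[R]_m -> T -> 'cV[R]_m) : Prop :=
  exists (G : R -> 'M[R]_(m, 2)) (C : 'M[R]_(m, 2)),
    (forall i j, square_integrable a b (fun t => G t i j)) /\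
    forall theta, exists2 I, wiener_integral_mx a b G (Y theta) I
      & forall w, Z theta w = I w + C *m Y theta a w.

Definition unbiased m (Z : 'cV[R]_m -> T -> 'cV[R]_m) : Prop :=
  forall theta i, 'E_P[fun w => (Z theta w i 0)%R]%E = (theta i 0)%:E.

Definition is_BLUE (a b : R) m
    (Y : 'cV[R]_m -> R -> T -> 'cV[R]_2) (Z : 'cV[R]_m -> T -> 'cV[R]_m) : Prop :=
  [/\ linear_estimator a b Y Z, unbiased Z
    & forall Z', linear_estimator a b Y Z' -> unbiased Z' ->
        forall theta, loewner_le (cov_mx (Z theta)) (cov_mx (Z' theta))].

Definition is_theta_hat (a b : R) m (F dF : R -> 'M[R]_(m, 2))
    (Sigma : 'M[R]_2) (Y : 'cV[R]_m -> R -> T -> 'cV[R]_2)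
    (Z : 'cV[R]_m -> T -> 'cV[R]_m) : Prop :=
  forall theta,
    exists2 I, wiener_integral_mx a b (fun t => dF t *m invmx Sigma) (Y theta) I
    & forall w, Z theta w = invmx (info_mx a b F dF Sigma) *m
        (I w + a^-1 *: (F a *m invmx Sigma *m Y theta a w)).

End processes.

(* Main.v *)
Require Import Defs.
From HB Require Import structures.
From mathcomp Require Import all_boot all_order all_algebra.
From mathcomp Require Import all_classical all_reals all_analysis.
From mathcomp Require Import measurable_realfun ring lra.

(** The theorem is a Gauss-Markov argument carried by the isometry of the
    Wiener integral.

    Fix theta and put m = F^T theta. The observed coordinates satisfy
    E[Y_j(t)] = m_j(t) and
    E[Y_j(s) Y_l(t)] = Sigma_jl min(s, t) + m_j(s) m_l(t)
    ([regression_mean], [regression_cov]). Increments over two intervals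
    therefore have covariance Sigma_jl times the length of the intersection, and
    this passes from step functions to mean-square limits ([ip_wieners]):
    integrals of g against Y_j and of h against Y_l have means int g dm_j and
    int h dm_l, and covariance Sigma_jl int g h. They are uncorrelated with
    Y(a), because increments after time a are.

    Hence, for a linear estimator with coefficients (G, C), the mean is
    K(G, C) theta with K(G, C) = int G dF^T + C F(a)^T ([bias_mx]), and the
    cross-covariance of two linear estimators is
    int G Sigma G'^T + a C Sigma C'^T ([cross_mx]). Unbiasedness means
    K(G, C) = 1. The estimator of the theorem has the coefficients
    G0 = M^-1 dF Sigma^-1 and C0 = a^-1 M^-1 F(a) Sigma^-1. In a
    cross-covariance with it, Sigma cancels and leaves
    K(G, C) M^-1 ([cross_mx_opt]), which is M^-1 for every unbiased (G, C). Since
    K(G0, C0) = M^-1 M = 1 ([bias_mx_opt]), this estimator is unbiased with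
    covariance M^-1. Any other unbiased linear estimator Z then differs from it
    by a vector that is uncorrelated with it, so that Cov Z - M^-1 is the
    covariance matrix of that difference ([ip_diff_opt]). This matrix is
    nonnegative definite; if Z is optimal too, its diagonal vanishes and
    the two estimators agree almost surely.

    That the Wiener integrals in the estimator exist follows from the same
    isometry: a continuous integrand is a uniform limit of step functions, whose
    integrals form a Cauchy sequence in a complete space
    ([step_approx], [L2_complete], [wiener_exists]). *)

Set Implicit Arguments.
Unset Strict Implicit.
Unset Printing Implicit Defensive.

Import Order.TTheory GRing.Theory Num.Theory.
Import numFieldNormedType.Exports.

Local Open Scope classical_set_scope.
Local Open Scope ring_scope.

(** * The inner product of square integrable functions *)

Section L2_form.
Context d (T : measurableType d) (R : realType).
Variables (mu : {measure set T -> \bar R}) (D : set T).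
Hypothesis mD : measurable D.
Implicit Types (f g h : T -> R) (c : R).

Definition L2 f : Prop :=
  measurable_fun D f /\ (\int[mu]_(x in D) (f x ^+ 2)%:E < +oo)%E.

(** Real-valued rather than extended, so that it is bilinear on square integrable
    functions and identities between second moments become ring identities. *)
Definition ip f g : R := \int[mu]_(x in D) (f x * g x).

Lemma L2_integrable_sqr f : L2 f -> mu.-integrable D (fun x => (f x ^+ 2)%:E).
Proof.
move=> [mf foo]; apply/integrableP; split.
  by apply/measurable_EFinP; exact: measurable_funX.
by under eq_integral do rewrite gee0_abs ?lee_fin ?sqr_ge0//.
Qed.

Lemma L2_integrable_mul f g :
  L2 f -> L2 g -> mu.-integrable D (fun x => (f x * g x)%:E).
Proof.
move=> Lf Lg; have [mf _] := Lf; have [mg _] := Lg.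
apply: (@le_integrable _ _ _ _ _ mD _ (fun x => (f x ^+ 2 + g x ^+ 2)%:E)).
- by apply/measurable_EFinP; exact: measurable_funM.
- move=> x Dx; rewrite /= lee_fin [leRHS]ger0_norm ?addr_ge0 ?sqr_ge0//.
  rewrite ler_norml; apply/andP; split; nra.
- under eq_fun do rewrite EFinD.
  by apply: integrableD => //; exact: L2_integrable_sqr.
Qed.

Lemma L2_lin c f g : L2 f -> L2 g -> L2 (c *: f + g).
Proof.
move=> Lf Lg; have [mf _] := Lf; have [mg _] := Lg; split.
  by apply: measurable_funD => //; exact: measurable_funM.
apply: integrable_lty => //.
rewrite (_ : (fun x => _) = (fun x => (c ^+ 2)%:E * (f x ^+ 2)%:E
    + ((2 * c)%:E * (f x * g x)%:E + (g x ^+ 2)%:E))%E); last first.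
  apply/funext => x /=; rewrite -!EFinM -!EFinD; congr EFin.
  by rewrite !fctE/= /GRing.scale/=; ring.
apply: integrableD => //; first by apply: integrableZl => //; exact: L2_integrable_sqr.
apply: integrableD => //; last exact: L2_integrable_sqr.
by apply: integrableZl => //; exact: L2_integrable_mul.
Qed.

Lemma L2_0 : L2 0.
Proof.
split; first exact: measurable_cst.
by rewrite integral0_eq ?ltry// => x _; rewrite expr0n.
Qed.

Lemma L2Z c f : L2 f -> L2 (c *: f).
Proof. by move=> Lf; rewrite -[_ *: _]addr0; apply: L2_lin => //; exact: L2_0. Qed.

Lemma L2D f g : L2 f -> L2 g -> L2 (f + g).
Proof. by move=> Lf Lg; rewrite -[f]scale1r; exact: L2_lin. Qed.

Lemma L2B f g : L2 f -> L2 g -> L2 (f - g).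
Proof. by move=> Lf Lg; rewrite addrC -scaleN1r; exact: L2_lin. Qed.

Lemma L2_sum (I : Type) (s : seq I) (Q : pred I) (F : I -> T -> R) :
  (forall i, Q i -> L2 (F i)) -> L2 (\sum_(i <- s | Q i) F i).
Proof. by move=> LF; elim/big_ind : _ => //; [exact: L2_0|exact: L2D]. Qed.

Lemma ipC f g : ip f g = ip g f.
Proof. by apply: eq_Rintegral => x _; rewrite mulrC. Qed.

Lemma ip_ge0 f : 0 <= ip f f.
Proof. by apply: Rintegral_ge0 => x _; rewrite -expr2 sqr_ge0. Qed.

Lemma EFin_ip f : L2 f -> (ip f f)%:E = (\int[mu]_(x in D) (f x ^+ 2)%:E)%E.
Proof.
move=> Lf; rewrite /ip /Rintegral fineK//.
by apply: integrable_fin_num => //; exact: L2_integrable_mul.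
Qed.

Lemma ip_linl c f g h : L2 f -> L2 g -> L2 h ->
  ip (c *: f + g) h = c * ip f h + ip g h.
Proof.
move=> Lf Lg Lh; rewrite /ip -RintegralZl//; last exact: L2_integrable_mul.
rewrite -RintegralD//; last 2 first.
- exact: (integrableZl mD c (L2_integrable_mul Lf Lh)).
- exact: L2_integrable_mul.
by apply: eq_Rintegral => x _; rewrite !fctE/= /GRing.scale/= mulrDl mulrA.
Qed.

Lemma ip0l h : ip 0 h = 0.
Proof.
rewrite /ip /Rintegral integral0_eq// => x _.
by rewrite [X in X%:E]mul0r.
Qed.

Lemma ipZl c f h : L2 f -> L2 h -> ip (c *: f) h = c * ip f h.
Proof.
move=> Lf Lh; rewrite -[c *: f]addr0 ip_linl//; last exact: L2_0.
by rewrite ip0l addr0.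
Qed.

Lemma ipDl f g h : L2 f -> L2 g -> L2 h -> ip (f + g) h = ip f h + ip g h.
Proof. by move=> Lf Lg Lh; rewrite -[f]scale1r ip_linl// mul1r scale1r. Qed.

Lemma ipBl f g h : L2 f -> L2 g -> L2 h -> ip (f - g) h = ip f h - ip g h.
Proof.
by move=> Lf Lg Lh; rewrite addrC -scaleN1r ip_linl// mulN1r addrC.
Qed.

Lemma ip_suml (I : eqType) (s : seq I) (F : I -> T -> R) h :
  (forall i, i \in s -> L2 (F i)) -> L2 h ->
  ip (\sum_(i <- s) F i) h = \sum_(i <- s) ip (F i) h.
Proof.
move=> LF Lh; elim: s LF => [|i s IHs] LF; first by rewrite !big_nil ip0l.
have LFs j : j \in s -> L2 (F j) by move=> js; apply: LF; rewrite inE js orbT.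
rewrite !big_cons ipDl ?IHs//; first by apply: LF; rewrite mem_head.
by rewrite big_seq; exact: L2_sum.
Qed.

Lemma ipZr c f h : L2 f -> L2 h -> ip h (c *: f) = c * ip h f.
Proof. by move=> Lf Lh; rewrite ipC ipZl// ipC. Qed.

Lemma ipDr f g h : L2 f -> L2 g -> L2 h -> ip h (f + g) = ip h f + ip h g.
Proof. by move=> Lf Lg Lh; rewrite ipC ipDl// ![ip _ h]ipC. Qed.

Lemma ipBr f g h : L2 f -> L2 g -> L2 h -> ip h (f - g) = ip h f - ip h g.
Proof. by move=> Lf Lg Lh; rewrite ipC ipBl// ![ip _ h]ipC. Qed.

Lemma ip_sumr (I : eqType) (s : seq I) (F : I -> T -> R) h :
  (forall i, i \in s -> L2 (F i)) -> L2 h ->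
  ip h (\sum_(i <- s) F i) = \sum_(i <- s) ip h (F i).
Proof. by move=> LF Lh; rewrite ipC ip_suml//; under eq_bigr do rewrite ipC. Qed.

(** The quadratic polynomial t |-> |t f + g|^2 is nonnegative. Evaluating it at its
    minimizer gives the inequality. If |f| = 0, there is no minimizer: the polynomial
    would then be affine in t, and negative somewhere unless its slope is 0. *)
Lemma ip_CauchySchwarz f g : L2 f -> L2 g -> ip f g ^+ 2 <= ip f f * ip g g.
Proof.
move=> Lf Lg.
have E t : ip (t *: f + g) (t *: f + g) = t ^+ 2 * ip f f + 2 * t * ip f g + ip g g.
  have Ltf := L2Z t Lf.
  rewrite ip_linl//; last exact: L2_lin.
  rewrite ipDr// ipZr// ipDr// ipZr// (ipC g f); ring.
have := ip_ge0 f; rewrite le_eqVlt => /predU1P[ff0|ff0].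
  suff -> : ip f g = 0 by rewrite -ff0 mul0r expr0n.
  apply/eqP/negPn/negP => fg0.
  (* the value of t at which the affine function equals -1 *)
  have := ip_ge0 ((- (ip g g + 1) / (2 * ip f g)) *: f + g).
  rewrite E -ff0 mulr0 add0r.
  rewrite (_ : _ + _ = - 1); first by rewrite oppr_ge0 ler10.
  by field.
have := ip_ge0 ((- ip f g / ip f f) *: f + g).
rewrite E (_ : _ + _ = (ip f f * ip g g - ip f g ^+ 2) / ip f f); last first.
  by field; rewrite gt_eqF.
by rewrite pmulr_lge0 ?invr_gt0// subr_ge0.
Qed.

Lemma ip_le_sqrt f g : L2 f -> L2 g ->
  `|ip f g| <= Num.sqrt (ip f f) * Num.sqrt (ip g g).
Proof.
move=> Lf Lg; rewrite -sqrtrM ?ip_ge0// -sqrtr_sqr ler_sqrt ?mulr_ge0 ?ip_ge0//.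
exact: ip_CauchySchwarz.
Qed.

Lemma ip_eq0_ae f : L2 f -> ip f f = 0 -> {ae mu, forall x, D x -> f x = 0}.
Proof.
move=> Lf f0; have [mf _] := Lf.
have mf2 : measurable_fun D (fun x => (f x ^+ 2)%:E).
  by apply/measurable_EFinP; exact: measurable_funX.
have /(ae_eq_integral_abs mu mD mf2) : (\int[mu]_(x in D) `|(f x ^+ 2)%:E| = 0)%E.
  under eq_integral do rewrite gee0_abs ?lee_fin ?sqr_ge0//.
  by rewrite -EFin_ip// f0.
by apply: filterS => x fx Dx; have [/eqP] := fx Dx; rewrite sqrf_eq0 => /eqP.
Qed.

Definition L2cvg (u : nat -> T -> R) f : Prop :=
  ip (u n - f) (u n - f) @[n --> \oo] --> (0 : R).

(** Cauchy-Schwarz: the factor that tends to 0 absorbs the bounded one. *)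
Lemma ip_cvg0 (u v : nat -> T -> R) (k : R) :
  (forall n, L2 (u n)) -> (forall n, L2 (v n)) ->
  ip (u n) (u n) @[n --> \oo] --> (0 : R) ->
  ip (v n) (v n) @[n --> \oo] --> k ->
  ip (u n) (v n) @[n --> \oo] --> (0 : R).
Proof.
move=> Lu Lv u0 vk; apply/norm_cvg0P.
apply: (@squeeze_cvgr _ _ _ _ (cst 0)
  (fun n => Num.sqrt (ip (u n) (u n)) * Num.sqrt (ip (v n) (v n)))).
- by apply: nearW => n; rewrite normr_ge0/= ip_le_sqrt.
- exact: cvg_cst.
- rewrite -[X in _ --> X](mul0r (Num.sqrt k)) -{1}sqrtr0.
  by apply: cvgM; apply: continuous_cvg => //; exact: sqrt_continuous.
Qed.

(** Passing to the limit in second moments; with a constant sequence equal to 1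
    it also gives the convergence of means. *)
Lemma ip_cvg (u v : nat -> T -> R) f g :
  (forall n, L2 (u n)) -> L2 f -> (forall n, L2 (v n)) -> L2 g ->
  L2cvg u f -> L2cvg v g -> ip (u n) (v n) @[n --> \oo] --> ip f g.
Proof.
move=> Lu Lf Lv Lg uf vg.
rewrite (_ : (fun n => _) = fun n => ip (u n - f) (v n - g) + ip (u n - f) g
    + ip (v n - g) f + ip f g); last first.
  apply/funext => n; rewrite ipBl// ?ipBr// ?ipBl//; last exact: L2B.
  by rewrite [ip (v n) f]ipC [ip g f]ipC; ring.
rewrite [X in _ --> X](_ : _ = 0 + 0 + 0 + ip f g); last by rewrite !add0r.
apply: cvgD; last exact: cvg_cst.
have LB (w : nat -> T -> R) h : (forall n, L2 (w n)) -> L2 h -> forall n, L2 (w n - h).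
  by move=> Lw Lh n; exact: L2B.
apply: cvgD.
  apply: cvgD; first exact: (ip_cvg0 (LB _ _ Lu Lf) (LB _ _ Lv Lg) uf vg).
  exact: (@ip_cvg0 _ (fun=> g) (ip g g) (LB _ _ Lu Lf) (fun=> Lg) uf (cvg_cst _)).
exact: (@ip_cvg0 _ (fun=> f) (ip f f) (LB _ _ Lv Lg) (fun=> Lf) vg (cvg_cst _)).
Qed.

Lemma L2cvg_cst f : L2cvg (fun=> f) f.
Proof.
rewrite /L2cvg; under eq_fun do rewrite subrr ip0l.
exact: cvg_cst.
Qed.

Lemma L2cvg_lin c (u v : nat -> T -> R) f g :
  (forall n, L2 (u n)) -> L2 f -> (forall n, L2 (v n)) -> L2 g ->
  L2cvg u f -> L2cvg v g -> L2cvg (fun n => c *: u n + v n) (c *: f + g).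
Proof.
move=> Lu Lf Lv Lg uf vg; rewrite /L2cvg.
have Luf n : L2 (u n - f) by exact: L2B.
have Lvg n : L2 (v n - g) by exact: L2B.
rewrite (_ : (fun n => _) = fun n => c ^+ 2 * ip (u n - f) (u n - f)
  + (2 * c * ip (u n - f) (v n - g) + ip (v n - g) (v n - g))); last first.
  apply/funext => n.
  have -> : c *: u n + v n - (c *: f + g) = c *: (u n - f) + (v n - g).
    by rewrite opprD addrACA -scalerBr.
  move: (u n - f) (v n - g) (Luf n) (Lvg n) => u' v' Lu' Lv'.
  have Lcu' := L2Z c Lu'.
  rewrite ip_linl//; last exact: L2D.
  rewrite ipDr// ipZr// ipDr// ipZr//.
  by rewrite [ip v' u']ipC; ring.
rewrite -[X in _ --> X](addr0 0); apply: cvgD.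
  by rewrite -[X in _ --> X](mulr0 (c ^+ 2)); apply: cvgMr.
rewrite -[X in _ --> X](addr0 0); apply: cvgD => //.
rewrite -[X in _ --> X](mulr0 (2 * c)); apply: cvgMr.
exact: (ip_cvg0 Luf Lvg uf vg).
Qed.

Lemma L2cvgP (u : nat -> T -> R) f : (forall n, L2 (u n)) -> L2 f ->
  L2cvg u f <->
  (\int[mu]_(x in D) ((u n x - f x) ^+ 2)%:E)%E @[n --> \oo] --> 0%E.
Proof.
move=> Lu Lf.
rewrite (_ : (fun n => _) = EFin \o (fun n => ip (u n - f) (u n - f))).
  split => [uf|/fine_cvg//].
  by apply: cvg_EFin; [exact: nearW|exact: uf].
by apply/funext => n /=; rewrite EFin_ip//; exact: L2B.
Qed.

End L2_form.

(** * Completeness of square integrable functions *)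

Section L2_completeness.
Context d (T : measurableType d) (R : realType).
Variable mu : {measure set T -> \bar R}.

(** The weights 2^n turn square summable increments into absolutely summable
    ones: |x| <= 2^-n + 2^n x^2. *)
Lemma cvgn_weighted_sqr (v : nat -> R) :
  (\sum_(n <oo) (2 ^+ n * (v n.+1 - v n) ^+ 2)%:E < +oo)%E -> cvgn v.
Proof.
move=> voo.
have w_ge0 n : 0 <= 2 ^+ n * (v n.+1 - v n) ^+ 2.
  by rewrite mulr_ge0 ?sqr_ge0 ?exprn_ge0.
have cw : cvgn (series (fun n => 2 ^+ n * (v n.+1 - v n) ^+ 2)).
  apply: nondecreasing_is_cvgn.
    move=> n m nm; rewrite /series/=.
    by rewrite (big_cat_nat (leq0n n) nm)/= lerDl sumr_ge0.
  exists (fine (\sum_(n <oo) (2 ^+ n * (v n.+1 - v n) ^+ 2)%:E)%E) => _ [n _ <-].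
  rewrite -lee_fin fineK; last first.
    by rewrite ge0_fin_numE// nneseries_ge0// => k _ _; rewrite lee_fin.
  rewrite /series/= -sumEFin.
  by apply: (@nneseries_lim_ge _ _ xpredT) => k _; rewrite lee_fin.
have cg : cvgn (series (fun k : nat => 2 / (2 ^ (k + 1))%:R : R)).
  by apply/cvg_ex; eexists; exact: cvg_geometric_series_half.
have cd : cvgn (series (telescope v)).
  apply: normed_cvg; apply: (series_le_cvg _ _ _ (is_cvg_seriesD cg cw)).
  - by move=> n; rewrite normr_ge0.
  - by move=> n /=; rewrite addr_ge0// divr_ge0.
  move=> n; rewrite -[leRHS]/(2 / (2 ^ (n + 1))%:R + 2 ^+ n * (v n.+1 - v n) ^+ 2).
  rewrite -[leLHS]/`|v n.+1 - v n|.
  have -> : 2 / (2 ^ (n + 1))%:R = (2 ^+ n)^-1 :> R.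
    by rewrite addn1 expnS natrM natrX invfM mulrA divff ?mul1r.
  set t : R := 2 ^+ n; have t0 : 0 < t by rewrite exprn_gt0.
  rewrite -(real_normK (num_real (v n.+1 - v n))).
  move: `|v n.+1 - v n| => y.
  have -> : t^-1 + t * y ^+ 2 = y + t^-1 * (1 - t * y + (t * y) ^+ 2).
    by field; rewrite gt_eqF.
  rewrite lerDl mulr_ge0 ?invr_ge0 ?(ltW t0)//; nra.
rewrite (_ : v = cst (v 0%N) \+ series (telescope v)).
  by apply: is_cvgD => //; exact: is_cvg_cst.
by apply/funext => n; rewrite {1}(eq_sum_telescope v n).
Qed.

(** The geometric Cauchy rate spares the extraction of a subsequence. The weighted
    sum of squared increments has a finite integral, so it is finite almost
    everywhere, and there the sequence converges pointwise by
    [cvgn_weighted_sqr]. Fatou's lemma then turns the Cauchy rate into a bound on the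
    distance to the pointwise limit. *)
Lemma L2_complete (u : nat -> T -> R) (K : R) :
  (forall n, L2 mu setT (u n)) ->
  (forall n m, (n <= m)%N ->
     ip mu setT (u m - u n) (u m - u n) <= K / 4 ^+ n) ->
  exists2 f, L2 mu setT f & L2cvg mu setT u f.
Proof.
move=> Lu uK.
have mT : measurable [set: T] by [].
have LB n m : L2 mu setT (u m - u n) by exact: L2B.
have mu_ n : measurable_fun setT (u n) by have [] := Lu n.
pose h x := (\sum_(n <oo) (2 ^+ n * (u n.+1 x - u n x) ^+ 2)%:E)%E.
have mterm n : measurable_fun setT (fun x => (2 ^+ n * (u n.+1 x - u n x) ^+ 2)%:E).
  apply/measurable_EFinP; apply: measurable_funM => //.
  by apply: measurable_funX; exact: measurable_funB.
have term_ge0 n x : (0 <= (2 ^+ n * (u n.+1 x - u n x) ^+ 2)%:E)%E.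
  by rewrite lee_fin mulr_ge0 ?sqr_ge0 ?exprn_ge0.
have mh : measurable_fun setT h.
  by apply: ge0_emeasurable_sum => // n x _ _; exact: term_ge0.
have h_ge0 x : (0 <= h x)%E by apply: nneseries_ge0.
have hoo : (\int[mu]_x h x < +oo)%E.
  rewrite integral_nneseries//.
  apply: (@le_lt_trans _ _ (\sum_(n <oo) ((2 * K) / (2 ^ (n + 1))%:R)%:E)%E).
    apply: lee_nneseries => [n _ _|n _]; first by apply: integral_ge0.
    under eq_integral do rewrite EFinM.
    rewrite ge0_integralZl//; last 2 first.
    - by apply/measurable_EFinP; apply: measurable_funX; exact: measurable_funB.
    - by move=> x _; rewrite lee_fin sqr_ge0.
    rewrite -(EFin_ip mT (LB n n.+1)) -EFinM lee_fin.
    have := uK n n.+1 (leqnSn n).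
    rewrite addn1 expnS natrM natrX -[X in _ / X ^+ n](_ : 2 * 2 = 4 :> R); last by ring.
    rewrite exprMn; set t : R := 2 ^+ n; have t0 : 0 < t by rewrite exprn_gt0.
    rewrite ler_pdivlMr ?mulr_gt0// => tK.
    rewrite ler_pdivlMr ?mulr_gt0//; nra.
  have -> : (\sum_(n <oo) ((2 * K) / (2 ^ (n + 1))%:R)%:E)%E = (2 * K / 2 ^+ 0)%:E :> \bar R.
    by apply/cvg_lim => //; exact: cvg_geometric_eseries_half.
  by rewrite ltry.
have ih : mu.-integrable setT h.
  by apply/integrableP; split=> //; under eq_integral do rewrite gee0_abs//.
pose A := [set x | h x \is a fin_num].
have mA : measurable A by rewrite -[A]setTI; exact: emeasurable_fin_num.
(* restricting to A makes the sequence converge at every point *)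
pose w n x := u n x * \1_A x.
have mw n : measurable_fun setT (w n) by exact: measurable_funM.
have cw x : cvgn (w ^~ x).
  have [xA|xA] := pselect (A x).
    rewrite /w indicE mem_set//; under eq_fun do rewrite mulr1.
    apply: cvgn_weighted_sqr; rewrite -/(h x).
    by move: xA; rewrite /A/= ge0_fin_numE.
  rewrite /w indicE memNset//; under eq_fun do rewrite mulr0.
  exact: is_cvg_cst.
pose f x := limn (w ^~ x).
have mf : measurable_fun setT f.
  by apply: (measurable_fun_cvg mw) => x _; exact: cw.
have wu : {ae mu, forall x, forall n, w n x = u n x}.
  have := integrable_ae measurableT ih; apply: filterS => x /(_ I) hx n.
  by rewrite /w indicE mem_set// mulr1.
have fu n : (\int[mu]_x ((f x - u n x) ^+ 2)%:E <= (K / 4 ^+ n)%:E)%E.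
  have -> : (\int[mu]_x ((f x - u n x) ^+ 2)%:E =
      \int[mu]_x limn_einf (fun m => ((w m x - w n x) ^+ 2)%:E))%E.
    have E x : limn_einf (fun m => ((w m x - w n x) ^+ 2)%:E) = ((f x - w n x) ^+ 2)%:E.
      have : ((w m x - w n x) ^+ 2)%:E @[m --> \oo] --> ((f x - w n x) ^+ 2)%:E.
        apply: cvg_EFin; first exact: nearW.
        have c : w m x - w n x @[m --> \oo] --> f x - w n x.
          by apply: cvgB; [exact: cw|exact: cvg_cst].
        exact: (cvgM c c).
      by move=> /cvg_limn_einf_sup[].
    under [RHS]eq_integral do rewrite E.
    apply: ge0_ae_eq_integral => //.
    - by apply/measurable_EFinP; apply: measurable_funX; exact: measurable_funB.
    - by apply/measurable_EFinP; apply: measurable_funX; exact: measurable_funB.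
    - by move=> x _; rewrite lee_fin sqr_ge0.
    - by move=> x _; rewrite lee_fin sqr_ge0.
    by apply: filterS wu => x wux _; rewrite wux.
  apply: (le_trans (fatou _ _ _ _)) => //.
  - move=> m.
    by apply/measurable_EFinP; apply: measurable_funX; exact: measurable_funB.
  - by move=> m x _; rewrite lee_fin sqr_ge0.
  have wK m : (n <= m)%N ->
      (\int[mu]_x ((w m x - w n x) ^+ 2)%:E <= (K / 4 ^+ n)%:E)%E.
    move=> nm; rewrite (_ : integral _ _ _ = (ip mu setT (u m - u n) (u m - u n))%:E).
      by rewrite lee_fin uK.
    rewrite EFin_ip//; apply: ge0_ae_eq_integral => //.
    - by apply/measurable_EFinP; apply: measurable_funX; exact: measurable_funB.
    - by apply/measurable_EFinP; apply: measurable_funX; exact: measurable_funB.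
    - by move=> x _; rewrite lee_fin sqr_ge0.
    - by move=> x _; rewrite lee_fin sqr_ge0.
    by apply: filterS wu => x wux _; rewrite !wux.
  rewrite limn_einf_lim; apply: lime_le; first exact: is_cvg_einfs.
  (* the infimum over indices at least m is bounded by the term at max(n, m) *)
  apply: nearW => m; apply: ge_ereal_inf.
  exists (\int[mu]_x ((w (maxn n m) x - w n x) ^+ 2)%:E)%E.
    by exists (maxn n m) => //=; exact: leq_maxr.
  by apply: wK; exact: leq_maxl.
have Lf : L2 mu setT f.
  rewrite -[f](subrK (u 0%N)); apply: L2D => //; split.
    by apply: measurable_funB.
  by apply: le_lt_trans (fu 0%N) _; rewrite ltry.
exists f => //; rewrite /L2cvg.
apply: (@squeeze_cvgr _ _ _ _ (cst 0) (fun n => K / 4 ^+ n)).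
- apply: nearW => n; rewrite ip_ge0//= -lee_fin EFin_ip//; last exact: L2B.
  by under eq_integral do rewrite -sqrrN opprB; exact: fu.
- exact: cvg_cst.
- have : K * 4^-1 ^+ n @[n --> \oo] --> K * 0.
    apply: cvgMr; apply: cvg_expr.
    by rewrite ger0_norm ?invr_ge0// invf_lt1// ltr1n.
  by rewrite mulr0; under eq_fun do rewrite exprVn.
Qed.

End L2_completeness.

(** * Step functions and primitives on an interval *)

Section interval_calculus.
Context (R : realType).
Variables (a b : R).
Implicit Types (f g m dm : R -> R) (q : seq (R * R * R)).

Notation ipL := (ip (@lebesgue_measure R) `[a, b]).
Notation L2L := (L2 (@lebesgue_measure R) `[a, b]).

Lemma within_continuous_eps g c e : {within `[a, b], continuous g} ->
  c \in `[a, b] -> 0 < e ->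
  exists2 d : R, 0 < d & forall y, y \in `[a, b] -> `|y - c| < d -> `|g c - g y| <= e.
Proof.
move=> /subspace_continuousP cg cab e0.
have /cvgrPdist_le/(_ _ e0) := cg c cab.
rewrite near_withinE => /nbhs_ballP[d /= d0 dP]; exists d => // y yab yc.
by apply: (dP y) => //; rewrite /ball/= distrC.
Qed.

Lemma L2_continuous g : {within `[a, b], continuous g} -> L2L g.
Proof.
move=> cg; have mg : measurable_fun `[a, b] g.
  by apply: subspace_continuous_measurable_fun => //; exact: measurable_itv.
split=> //; apply: integrable_lty => //.
apply: (@continuous_compact_integrable _ (fun x => g x ^+ 2)).
  exact: segment_compact.
by move=> x; apply: (cvgM (cg x) (cg x)).
Qed.

Lemma L2_indic A : measurable A -> L2L \1_A.
Proof.
move=> mA; split; first exact: measurable_indic.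
apply: (@le_lt_trans _ _ (\int[lebesgue_measure]_(x in `[a, b]) (\1_A x)%:E)%E).
  apply: ge0_le_integral => //=.
  - by apply/measurable_EFinP; apply: measurable_funX; exact: measurable_indic.
  - by apply/measurable_EFinP; exact: measurable_indic.
  by move=> x _; rewrite lee_fin indicE; case: (_ \in _); rewrite ?expr1n ?expr0n.
rewrite integral_indic//; apply: (@le_lt_trans _ _ (lebesgue_measure `[a, b])).
  by apply: le_measure; rewrite ?inE//; exact: measurableI.
by rewrite lebesgue_measure_itv/=; case: ifP => _; rewrite ?ltry.
Qed.

Lemma step_funE q : step_fun q = \sum_(e <- q) e.1.1 *: (\1_(`]e.1.2, e.2]) : R -> R).
Proof.
by apply/funext => x; rewrite /step_fun fct_sumE.
Qed.

Lemma L2_step q : L2L (step_fun q).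
Proof.
rewrite step_funE; apply: L2_sum => // e _; apply: L2Z => //.
by apply: L2_indic; exact: measurable_itv.
Qed.

Lemma step_fun_cat q q' : step_fun (q ++ q') = step_fun q + step_fun q'.
Proof. by apply/funext => x; rewrite /step_fun big_cat. Qed.

(** With concatenation as the sum, this makes lists of weighted intervals represent
    linear combinations of step functions. *)
Definition step_scale (c : R) q := [seq ((c * e.1.1, e.1.2), e.2) | e <- q].

Lemma step_fun_scale c q : step_fun (step_scale c q) = c *: step_fun q.
Proof.
apply/funext => x; rewrite /step_fun big_map/= [RHS]mulr_sumr.
by apply: eq_bigr => e _; rewrite mulrA.
Qed.

Lemma step_on_cat q q' : step_on a b q -> step_on a b q' -> step_on a b (q ++ q').
Proof. by move=> Hq Hq' e; rewrite mem_cat => /orP[/Hq|/Hq']. Qed.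

Lemma step_on_scale c q : step_on a b q -> step_on a b (step_scale c q).
Proof. by move=> Hq _ /mapP[e eq ->]/=; exact: Hq. Qed.

(** The length of the intersection, written as the same combination of minima
    that bilinearity produces from the covariance min(s, t) of Brownian motion. *)
Lemma ip_indic_itv s t s' t' :
  a <= s -> s <= t -> t <= b -> a <= s' -> s' <= t' -> t' <= b ->
  ipL \1_(`]s, t]) \1_(`]s', t']) =
    Num.min t t' - Num.min t s' - Num.min s t' + Num.min s s'.
Proof.
move=> as_ st tb as' st' tb'.
rewrite /ip; under eq_Rintegral do rewrite -[_ * _]/((\1_(`]s, t]) \* \1_(`]s', t'])) _) -indicI.
rewrite /Rintegral integral_indic//; last by apply: measurableI; exact: measurable_itv.
rewrite (_ : _ `&` _ `&` _ = [set` `]Num.max s s', Num.min t t']]); last first.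
  apply/seteqP; split=> x /=; rewrite !in_itv/= gt_max le_min.
    by move=> [[/andP[-> ->] /andP[-> ->]]].
  move=> /andP[/andP[sx s'x] /andP[xt xt']]; rewrite sx s'x xt xt'; split=> //.
  by apply/andP; split; lra.
rewrite [X in fine X](lebesgue_measure_itv `]Num.max s s', Num.min t t'])/= lte_fin /Num.min /Num.max.
by case: (ltP s s') => ?; case: (ltP t t') => ?; do ![case: ltP => /= ?]; lra.
Qed.

Lemma derivative_on_eps m dm x e : derivative_on a b m dm -> x \in `[a, b] -> 0 < e ->
  exists2 d : R, 0 < d & forall y, y \in `[a, b] -> y != x -> `|y - x| < d ->
    `|dm x - (y - x)^-1 * (m y - m x)| <= e.
Proof.
move=> dP xab e0; have /cvgrPdist_le/(_ _ e0) := dP x xab.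
rewrite near_withinE /dnbhs near_withinE => /nbhs_ballP[d /= d0 dd]; exists d => // y yab yx yd.
by apply: (dd y) => //; rewrite /ball/= distrC.
Qed.

(** A difference quotient close to the derivative is bounded by |f'| + 1, which
    gives continuity at the end points of the interval as well. *)
Lemma derivative_on_continuous m dm x e : derivative_on a b m dm -> x \in `[a, b] -> 0 < e ->
  exists2 d : R, 0 < d & forall y, y \in `[a, b] -> `|y - x| < d -> `|m x - m y| <= e.
Proof.
move=> dP xab e0; have [d d0 dd] := derivative_on_eps dP xab ltr01.
pose k := `|dm x| + 1; have k0 : 0 < k by rewrite ltr_wpDl.
exists (Num.min d (e / k)) => [|y yab]; first by rewrite lt_min d0 divr_gt0.
rewrite lt_min => /andP[yd yk].
have [->|yx] := eqVneq y x; first by rewrite subrr normr0 ltW.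
have yx0 : y - x != 0 by rewrite subr_eq0.
rewrite distrC (_ : m y - m x = ((y - x)^-1 * (m y - m x)) * (y - x)); last by field.
rewrite normrM; apply: (@le_trans _ _ (k * (e / k))); last first.
  by rewrite mulrCA divff ?mulr1// gt_eqF.
apply: ler_pM => //; last exact: ltW.
rewrite -[X in `|X|](subKr (dm x)).
by apply: (le_trans (ler_normB _ _)); rewrite lerD2l; exact: dd.
Qed.

(** The points s and t may be a and b, where the derivative is one-sided. There the
    fundamental theorem of calculus asks only for continuity of the primitive,
    which [derivative_on_continuous] provides. *)
Lemma FTC_on m dm s t : derivative_on a b m dm -> {within `[a, b], continuous dm} ->
  a <= s -> s <= t -> t <= b ->
  ipL \1_(`]s, t]) dm = m t - m s.
Proof.
move=> dP cdm as_ st tb.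
have -> : ipL \1_(`]s, t]) dm = \int[lebesgue_measure]_(x in `]s, t]) dm x.
  rewrite [RHS](_ : _ = \int[lebesgue_measure]_(x in `[a, b] `&` `]s, t]) dm x).
    rewrite Rintegral_mkcondr; apply: eq_Rintegral => x _.
    by rewrite patchE indicE; case: (_ \in _); rewrite ?mul1r ?mul0r.
  congr Rintegral; apply/seteqP; split=> x /=; rewrite !in_itv/=; last by case.
  by move=> /andP[sx xt]; split; apply/andP; split; lra.
move: st; rewrite le_eqVlt => /predU1P[<-|st].
  by rewrite set_itvoc0 Rintegral_set0 subrr.
have sub : `[s, t] `<=` `[a, b].
  by move=> x /=; rewrite !in_itv/= => /andP[sx xt]; apply/andP; split; lra.
have cst_ : {within `[s, t], continuous dm} by apply: continuous_subspaceW cdm.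
have dm_cvg x : x \in `]s, t[ -> h^-1 *: (m (h + x) - m x) @[h --> 0^'] --> dm x.
  rewrite in_itv/= => /andP[sx xt].
  have xab : x \in `[a, b] by rewrite in_itv/=; apply/andP; split; lra.
  apply/cvgrPdist_le => e e0.
  have [d d0 dd] := derivative_on_eps dP xab e0.
  pose d' := Num.min d (Num.min (x - s) (t - x)).
  have d'0 : 0 < d' by rewrite !lt_min d0 !subr_gt0 sx xt.
  near=> h.
  have h0 : h != 0 by near: h; exact: nbhs_dnbhs_neq.
  have : `|h| < d' by near: h; exact: dnbhs0_lt.
  rewrite !lt_min => /andP[hd /andP[]]; rewrite !ltr_norml => /andP[h1 h2] /andP[h3 h4].
  have := dd (h + x); rewrite addrK; apply=> //.
    by rewrite in_itv/=; apply/andP; split; lra.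
  by rewrite -subr_eq0 addrK.
rewrite Rintegral_itv_obnd_cbnd; last first.
  have := continuous_compact_integrable (@segment_compact _ s t) cst_.
  by apply: integrableS => //; exact: subset_itv_oc_cc.
rewrite /Rintegral (@continuous_FTC2 _ _ m _ _ st cst_) -?EFinB//.
  split.
  - by move=> x /dm_cvg xst; apply/cvg_ex; exists (dm x); under eq_fun do rewrite /= scaler1.
  - have sab : s \in `[a, b] by rewrite in_itv/=; apply/andP; split; lra.
    apply/cvgrPdist_le => e e0.
    have [d d0 dd] := derivative_on_continuous dP sab e0.
    near=> x; have sx : s < x by near: x; exact: nbhs_right_gt.
    have xt : x < t by near: x; exact: nbhs_right_lt.
    have xd : x < s + d by near: x; apply: nbhs_right_lt; rewrite ltrDl.
    apply: dd; first by rewrite in_itv/=; apply/andP; split; lra.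
    by rewrite ltr_norml; apply/andP; split; lra.
  - have tab : t \in `[a, b] by rewrite in_itv/=; apply/andP; split; lra.
    apply/cvgrPdist_le => e e0.
    have [d d0 dd] := derivative_on_continuous dP tab e0.
    near=> x; have sx : x < t by near: x; exact: nbhs_left_lt.
    have xt : s < x by near: x; exact: nbhs_left_gt.
    have xd : t - d < x by near: x; apply: nbhs_left_gt; rewrite gtrDl oppr_lt0.
    apply: dd; first by rewrite in_itv/=; apply/andP; split; lra.
    by rewrite ltr_norml; apply/andP; split; lra.
by move=> x /dm_cvg xst; apply/cvg_lim.
Unshelve. all: by end_near. Qed.

Lemma ip_le_bound f k : L2L f -> a <= b -> (forall x, x \in `]a, b] -> f x ^+ 2 <= k) ->
  ipL f f <= k * (b - a).
Proof.
move=> Lf ab fk; have [mf _] := Lf.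
have sub : [set` `]a, b]] `<=` `[a, b] by exact: subset_itv_oc_cc.
have mf2 : measurable_fun `]a, b] (fun x => (f x ^+ 2)%:E).
  apply: (measurable_funS (measurable_itv _) sub).
  by apply/measurable_EFinP; exact: measurable_funX.
rewrite -lee_fin EFin_ip//.
rewrite -integral_itv_obnd_cbnd//.
apply: (@le_trans _ _ (\int[lebesgue_measure]_(x in `]a, b]) k%:E)%E).
  have [ab'|] := boolP (a < b); last first.
    by rewrite -leNgt => ba; rewrite set_itv_ge ?integral_set0//= bnd_simp -leNgt.
  have k0 : 0 <= k.
    by apply: le_trans (fk b _); rewrite ?sqr_ge0// in_itv/= ab' lexx.
  by apply: ge0_le_integral => //= x _; rewrite lee_fin sqr_ge0.
rewrite integral_cst//= [X in (_ * X)%E](lebesgue_measure_itv `]a, b])/= lte_fin.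
by move: ab; rewrite le_eqVlt => /predU1P[->|->]; rewrite ?ltxx ?subrr ?mule0 ?mulr0//
  -EFinB -EFinM.
Qed.

(** Real induction: let c be the supremum of the points z such that the function is
    approximated on ]a, z]. Continuity at c allows one more constant piece, which crosses
    c unless c = b. A step function made of intervals open on the left cannot
    approximate the value at a itself. *)
Lemma step_approx g e : a <= b -> {within `[a, b], continuous g} -> 0 < e ->
  exists2 q, step_on a b q & forall x, x \in `]a, b] -> `|step_fun q x - g x| <= e.
Proof.
move=> ab cg e0.
pose ap z := exists q, [/\ step_on a b q,
  forall x, a < x <= z -> `|step_fun q x - g x| <= e
  & forall x, z < x -> step_fun q x = 0].
pose E := [set z | a <= z <= b /\ ap z].
have Ea : E a.
  split; first by rewrite lexx.
  exists [::]; split => //; first by move=> x; rewrite lt_le_asym.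
  by move=> x _; rewrite /step_fun big_nil.
have ubE : ubound E b by move=> z [/andP[]].
have hsE : has_sup E by split; [exists a|exists b].
pose c := sup E.
have ac : a <= c by exact: (ub_le_sup (proj2 hsE) Ea).
have cb : c <= b by apply: sup_le_ub => //; exists a.
have cab : c \in `[a, b] by rewrite in_itv/= ac.
have [d d0 dd] := within_continuous_eps cg cab e0.
have [x [/andP[ax xb] [q [qab qx q0]]] cx] := sup_adherent d0 hsE.
rewrite -/c in cx.
(* halving d keeps ]x, z] within distance d of c, yet z > c unless z = b *)
pose z := Num.min (c + d / 2) b.
have zb : z <= b by rewrite ge_min lexx orbT.
have xc : x <= c by apply: (ub_le_sup (proj2 hsE)); split; [rewrite ax|exists q].
have cz : c <= z by rewrite le_min cb andbT; lra.
have zd : z < c + d by rewrite gt_min; apply/orP; left; lra.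
have apz : ap z.
  exists (q ++ [:: ((g c, x), z)]); split.
  - apply: step_on_cat => // e'; rewrite inE => /eqP->/=.
    by split=> //; exact: le_trans cz.
  - move=> y /andP[ay yz]; rewrite step_fun_cat fctE.
    have [yx|xy] := leP y x.
      rewrite [X in _ + X - _](_ : _ = 0) ?addr0 ?qx ?ay//.
      by rewrite /step_fun big_seq1 indicE memNset ?mulr0//= in_itv/= ltNge yx.
    rewrite q0// add0r /step_fun big_seq1 indicE mem_set ?mulr1//=; last first.
      by rewrite in_itv/= xy yz.
    by apply: dd; rewrite ?in_itv/= ?ltr_norml; apply/andP; split; lra.
  - move=> y zy; rewrite step_fun_cat fctE q0; last by lra.
    rewrite add0r /step_fun big_seq1 indicE memNset ?mulr0//= in_itv/=.
    by apply/negP; rewrite negb_and -!ltNge zy orbT.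
have zc : z <= c.
  by apply: (ub_le_sup (proj2 hsE)); split=> //; rewrite zb andbT (le_trans ac).
have zEb : z = b.
  by move: zc; rewrite /z /Num.min; case: ltP => //; lra.
by move: apz; rewrite zEb => -[q' [q'ab q'x _]]; exists q'.
Qed.

End interval_calculus.

(** * Second moments of integrals of step functions *)

Section Lfun_L2.
Context d (T : measurableType d) (R : realType) (P : probability T R).

Lemma Lfun2P (f : T -> R) : f \in Lfun P 2%:E <-> L2 P setT f.
Proof.
split=> [Lf|[mf foo]].
  split; last by apply: integrable_lty => //; exact: Lfun2_integrable_sqr.
  by have := sub_Lfun_mfun Lf; rewrite inE.
rewrite inE; apply/andP; split; rewrite inE//=.
rewrite /finite_norm unlock/=; apply: poweR_lty.
apply: le_lt_trans foo; apply: ge0_le_integral => //=.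
- apply/measurable_EFinP.
  apply/(@measurableT_comp _ _ _ _ _ _ (fun x : R => x `^ 2)%R) => //.
  exact/measurableT_comp.
- by apply/measurable_EFinP; exact: measurable_funX.
- by move=> x _; rewrite powR_mulrn// real_normK ?num_real.
Qed.

Lemma ip_E (f g : T -> R) : L2 P setT f -> L2 P setT g ->
  ('E_P[f \* g] = (ip P setT f g)%:E)%E.
Proof.
move=> Lf Lg; rewrite unlock /ip /Rintegral fineK//.
by apply: integrable_fin_num => //; exact: L2_integrable_mul.
Qed.

Lemma L2_1 : L2 P setT (1 : T -> R).
Proof. by apply/Lfun2P; exact: Lfun_cst. Qed.

Lemma ip_E1 (f : T -> R) : L2 P setT f -> ('E_P[f] = (ip P setT f 1)%:E)%E.
Proof.
move=> Lf; rewrite -ip_E//; last exact: L2_1.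
by congr expectation; apply/funext => w /=; rewrite mulr1.
Qed.

Lemma ip_11 : ip P setT 1 1 = 1.
Proof.
apply: EFin_inj; rewrite -ip_E1; last exact: L2_1.
exact: (@expectation_cst _ _ _ P 1).
Qed.

End Lfun_L2.

Section step_integrals.
Context d (T : measurableType d) (R : realType) (P : probability T R).
Variables (a b : R).
Implicit Types (X : R -> T -> R) (m dm g : R -> R) (q : seq (R * R * R)).

Notation ipL := (ip (@lebesgue_measure R) `[a, b]).
Notation L2L := (L2 (@lebesgue_measure R) `[a, b]).
Notation ipP := (ip P setT).
Notation L2P := (L2 P setT).

(** The conclusion of the fundamental theorem of calculus, as a property of the pair
    (m, dm). It passes to linear combinations ([primitive_on_sum]), and so from the
    entries of F to the mean function of the process. *)
Definition primitive_on m dm : Prop := L2L dm /\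
  forall s t, a <= s -> s <= t -> t <= b -> ipL \1_(`]s, t]) dm = m t - m s.

Definition L2_process X : Prop := forall t, t \in `[a, b] -> L2P (X t).

Lemma step_integralE q X :
  step_integral q X = \sum_(e <- q) e.1.1 *: (X e.2 - X e.1.2).
Proof. by apply/funext => w; rewrite /step_integral fct_sumE. Qed.

Lemma step_integral_cat q q' X :
  step_integral (q ++ q') X = step_integral q X + step_integral q' X.
Proof. by rewrite !step_integralE big_cat. Qed.

Lemma step_integral_scale c q X :
  step_integral (step_scale c q) X = c *: step_integral q X.
Proof.
rewrite !step_integralE big_map scaler_sumr.
by apply: eq_bigr => e _; rewrite scalerA.
Qed.

Lemma step_endpoints q e : step_on a b q -> e \in q ->
  e.2 \in `[a, b] /\ e.1.2 \in `[a, b].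
Proof.
move=> qab /qab[ae ee eb]; rewrite !in_itv/=.
by rewrite ae eb (le_trans ae ee) (le_trans ee eb).
Qed.

Lemma L2_increment q X e : L2_process X -> step_on a b q -> e \in q ->
  L2P (X e.2 - X e.1.2).
Proof. by move=> LX qab /(step_endpoints qab)[? ?]; apply: L2B => //; exact: LX. Qed.

Lemma L2_step_integral q X : L2_process X -> step_on a b q -> L2P (step_integral q X).
Proof.
move=> LX qab; rewrite step_integralE big_seq; apply: L2_sum => // e eq.
by apply: L2Z => //; exact: (L2_increment LX qab).
Qed.

Lemma ip_step_fun q m dm : step_on a b q -> primitive_on m dm ->
  ipL (step_fun q) dm = \sum_(e <- q) e.1.1 * (m e.2 - m e.1.2).
Proof.
move=> qab [Ldm dmE]; have mI : measurable `[a, b] by exact: measurable_itv.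
have LI e : L2L \1_(`]e.1.2 : R, e.2 : R]) by apply: L2_indic; exact: measurable_itv.
rewrite step_funE ip_suml//; last by move=> e _; apply: L2Z.
rewrite big_seq [RHS]big_seq; apply: eq_bigr => e /qab[ae ee eb].
by rewrite ipZl// dmE.
Qed.

(** The constant k disappears in the increments of the process. The cases of
    interest are Z = 1, which gives means, and Z = the initial value of a process. *)
Lemma ip_step_integral q X Z m dm k l :
  L2_process X -> L2P Z -> step_on a b q -> primitive_on m dm ->
  (forall t, t \in `[a, b] -> ipP (X t) Z = k + l * m t) ->
  ipP (step_integral q X) Z = l * ipL (step_fun q) dm.
Proof.
move=> LX LZ qab mdm XZ; rewrite (ip_step_fun qab mdm) step_integralE.
rewrite ip_suml//; last first.
  by move=> e eq; apply: L2Z => //; exact: (L2_increment LX qab).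
rewrite mulr_sumr big_seq [RHS]big_seq; apply: eq_bigr => e eq.
have [e2 e1] := step_endpoints qab eq.
rewrite ipZl//; last exact: (L2_increment LX qab).
by rewrite ipBl ?XZ//; [ring|exact: LX|exact: LX].
Qed.

(** Bilinearity reduces this isometry to two intervals, where it is
    [ip_indic_itv]. *)
Lemma ip_step_integrals q q' X X' m dm m' dm' v :
  L2_process X -> L2_process X' -> step_on a b q -> step_on a b q' ->
  primitive_on m dm -> primitive_on m' dm' ->
  (forall s t, s \in `[a, b] -> t \in `[a, b] ->
     ipP (X s) (X' t) = v * Num.min s t + m s * m' t) ->
  ipP (step_integral q X) (step_integral q' X') =
    v * ipL (step_fun q) (step_fun q') +
    ipL (step_fun q) dm * ipL (step_fun q') dm'.
Proof.
move=> LX LX' qab q'ab mdm mdm' XX'.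
rewrite (ip_step_fun qab mdm) (ip_step_fun q'ab mdm') !step_integralE !step_funE.
have mI : measurable `[a, b] by exact: measurable_itv.
have LI (e : R * R * R) : L2L \1_(`]e.1.2, e.2]).
  by apply: L2_indic; exact: measurable_itv.
have LI' (e : R * R * R) : L2L (e.1.1 *: (\1_(`]e.1.2, e.2]) : R -> R)) by exact: L2Z.
have LXe e : e \in q -> L2P (e.1.1 *: (X e.2 - X e.1.2)).
  by move=> eq; apply: L2Z => //; exact: (L2_increment LX qab).
have LXe' e : e \in q' -> L2P (e.1.1 *: (X' e.2 - X' e.1.2)).
  by move=> eq; apply: L2Z => //; exact: (L2_increment LX' q'ab).
rewrite !ip_suml//; last 2 first.
- by rewrite big_seq; apply: L2_sum.
- by rewrite big_seq; apply: L2_sum.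
rewrite [v * _]mulr_sumr mulr_suml -big_split/= big_seq [RHS]big_seq.
apply: eq_bigr => e eq.
rewrite !ip_sumr//; last exact: LXe.
rewrite !mulr_sumr -big_split/= big_seq [RHS]big_seq.
apply: eq_bigr => e' eq'.
have [e2 e1] := step_endpoints qab eq; have [e2' e1'] := step_endpoints q'ab eq'.
have [ae ee eb] := qab _ eq; have [ae' ee' eb'] := q'ab _ eq'.
have LD := L2_increment LX qab eq; have LD' := L2_increment LX' q'ab eq'.
have [? ? ? ?] : [/\ L2P (X e.2), L2P (X e.1.2), L2P (X' e'.2) & L2P (X' e'.1.2)].
  by split; [exact: LX|exact: LX|exact: LX'|exact: LX'].
rewrite ipZl ?ipZr//; last exact: L2Z.
rewrite ipZl ?ipZr// ip_indic_itv//.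
by rewrite ipBl// !ipBr// !XX'//; ring.
Qed.

End step_integrals.

(** * Wiener integrals *)

Section wiener.
Context d (T : measurableType d) (R : realType) (P : probability T R).
Variables (a b : R).
Hypothesis ab : a <= b.
Implicit Types (X : R -> T -> R) (m dm g : R -> R) (q : seq (R * R * R)).

Notation ipL := (ip (@lebesgue_measure R) `[a, b]).
Notation L2L := (L2 (@lebesgue_measure R) `[a, b]).
Notation ipP := (ip P setT).
Notation L2P := (L2 P setT).
Notation L2_process := (L2_process P a b).
Notation primitive_on := (primitive_on a b).

Let mI : measurable ([set` `[a, b]] : set (measurableTypeR R)) := measurable_itv _.

Lemma wiener_integralP g X (I : T -> R) : L2_process X -> L2L g ->
  wiener_integral P a b g X I <->
  L2P I /\ exists q : nat -> seq (R * R * R),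
    [/\ forall n, step_on a b (q n),
        L2cvg (@lebesgue_measure R) `[a, b] (fun n => step_fun (q n)) g
      & L2cvg P setT (fun n => step_integral (q n) X) I].
Proof.
move=> LX Lg; split=> [[/Lfun2P LI [q [qab qg qI]]]|[LI [q [qab qg qI]]]].
  split=> //; exists q; split=> //.
    by apply/L2cvgP => // n; exact: (L2_step a b).
  apply/L2cvgP => //; first by move=> n; exact: (L2_step_integral LX).
  by move: qI; rewrite unlock.
split; first exact/Lfun2P.
exists q; split=> //.
  by apply/L2cvgP => // n; exact: (L2_step a b).
rewrite unlock; apply/L2cvgP => // n; exact: (L2_step_integral LX).
Qed.

Lemma L2_wiener g X I : wiener_integral P a b g X I -> L2P I.
Proof. by case=> /Lfun2P. Qed.

Lemma ip_wiener g X (I Z : T -> R) m dm k l :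
  L2_process X -> L2L g -> L2P Z -> primitive_on m dm ->
  (forall t, t \in `[a, b] -> ipP (X t) Z = k + l * m t) ->
  wiener_integral P a b g X I -> ipP I Z = l * ipL g dm.
Proof.
move=> LX Lg LZ mdm XZ /(wiener_integralP _ LX Lg)[LI [q [qab qg qI]]].
have [Ldm _] := mdm.
have LSI n := L2_step_integral LX (qab n).
have LSF n := L2_step a b (q n).
have /cvg_lim <- // := ip_cvg (measurableT : measurable [set: T]) LSI LI (fun=> LZ) LZ qI (L2cvg_cst _ _ Z).
apply/cvg_lim => //.
under eq_fun do rewrite (ip_step_integral LX LZ (qab _) mdm XZ).
by apply: cvgMr; exact: (ip_cvg mI LSF Lg (fun=> Ldm) Ldm qg (L2cvg_cst (@lebesgue_measure R) _ dm)).
Qed.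

(** The Wiener isometry, by passing to the limit in [ip_step_integrals]. The last
    summand is the product of the means of I and I', so v times the inner product
    of g and g' is their covariance. *)
Lemma ip_wieners g g' X X' (I I' : T -> R) m dm m' dm' v :
  L2_process X -> L2_process X' -> L2L g -> L2L g' ->
  primitive_on m dm -> primitive_on m' dm' ->
  (forall s t, s \in `[a, b] -> t \in `[a, b] ->
     ipP (X s) (X' t) = v * Num.min s t + m s * m' t) ->
  wiener_integral P a b g X I -> wiener_integral P a b g' X' I' ->
  ipP I I' = v * ipL g g' + ipL g dm * ipL g' dm'.
Proof.
move=> LX LX' Lg Lg' mdm mdm' XX'.
move=> /(wiener_integralP _ LX Lg)[LI [q [qab qg qI]]].
move=> /(wiener_integralP _ LX' Lg')[LI' [q' [q'ab q'g qI']]].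
have [Ldm _] := mdm; have [Ldm' _] := mdm'.
have LSI n := L2_step_integral LX (qab n).
have LSI' n := L2_step_integral LX' (q'ab n).
have LSF n := L2_step a b (q n).
have LSF' n := L2_step a b (q' n).
have /cvg_lim <- // := ip_cvg (measurableT : measurable [set: T]) LSI LI LSI' LI' qI qI'.
apply/cvg_lim => //.
under eq_fun do rewrite (ip_step_integrals LX LX' (qab _) (q'ab _) mdm mdm' XX').
apply: cvgD; first by apply: cvgMr; exact: (ip_cvg mI LSF Lg LSF' Lg' qg q'g).
by apply: cvgM; [exact: (ip_cvg mI LSF Lg (fun=> Ldm) Ldm qg (L2cvg_cst (@lebesgue_measure R) _ dm))|
  exact: (ip_cvg mI LSF' Lg' (fun=> Ldm') Ldm' q'g (L2cvg_cst (@lebesgue_measure R) _ dm'))].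
Qed.

Lemma wiener0 X : L2_process X -> wiener_integral P a b 0 X 0.
Proof.
move=> LX; apply/wiener_integralP => //; first exact: L2_0.
split; first exact: L2_0.
exists (fun=> [::]); split=> //.
- rewrite (_ : step_fun [::] = 0); first exact: L2cvg_cst.
  by rewrite step_funE big_nil.
- rewrite (_ : step_integral [::] X = 0); first exact: L2cvg_cst.
  by rewrite step_integralE big_nil.
Qed.

Lemma wiener_lin c g g' X (I I' : T -> R) : L2_process X -> L2L g -> L2L g' ->
  wiener_integral P a b g X I -> wiener_integral P a b g' X I' ->
  wiener_integral P a b (c *: g + g') X (c *: I + I').
Proof.
move=> LX Lg Lg'.
move=> /(wiener_integralP _ LX Lg)[LI [q [qab qg qI]]].
move=> /(wiener_integralP _ LX Lg')[LI' [q' [q'ab q'g qI']]].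
have mT : measurable [set: T] by [].
apply/wiener_integralP => //; first exact: L2_lin.
split; first exact: L2_lin.
exists (fun n => step_scale c (q n) ++ q' n); split.
- by move=> n; apply: step_on_cat => //; exact: step_on_scale.
- rewrite (_ : (fun n => _) = fun n => c *: step_fun (q n) + step_fun (q' n)).
    by apply: L2cvg_lin => // n; exact: (L2_step a b).
  by apply/funext => n; rewrite step_fun_cat step_fun_scale.
- rewrite (_ : (fun n => _) = fun n =>
      c *: step_integral (q n) X + step_integral (q' n) X).
    by apply: L2cvg_lin => // n; exact: (L2_step_integral LX).
  by apply/funext => n; rewrite step_integral_cat step_integral_scale.
Qed.

Lemma wiener_sum n (c : 'I_n -> R) (g : 'I_n -> R -> R) X (I : 'I_n -> T -> R) :
  L2_process X -> (forall k, L2L (g k)) ->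
  (forall k, wiener_integral P a b (g k) X (I k)) ->
  wiener_integral P a b (\sum_k c k *: g k) X (\sum_k c k *: I k).
Proof.
move=> LX Lg gI.
suff [] : L2L (\sum_k c k *: g k) /\
    wiener_integral P a b (\sum_k c k *: g k) X (\sum_k c k *: I k) by [].
elim/big_ind2 : _.
- by split; [exact: L2_0|exact: wiener0].
- move=> g1 I1 g2 I2 [Lg1 W1] [Lg2 W2]; split; first exact: L2D.
  by rewrite -[g1]scale1r -[I1]scale1r; exact: wiener_lin.
- move=> k _; split; first exact: L2Z.
  rewrite -[c k *: g k]addr0 -[c k *: I k]addr0.
  by apply: wiener_lin => //; [exact: L2_0|exact: wiener0].
Qed.

(** Approximate g uniformly within 2^-n by step functions. By the isometry and
    Cauchy-Schwarz, the norm of a step integral is at most a constant times the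
    norm of the step function, so the step integrals are a Cauchy sequence. *)
Lemma wiener_exists g X m dm v : L2_process X -> {within `[a, b], continuous g} ->
  primitive_on m dm -> 0 <= v ->
  (forall s t, s \in `[a, b] -> t \in `[a, b] ->
     ipP (X s) (X t) = v * Num.min s t + m s * m t) ->
  exists I, wiener_integral P a b g X I.
Proof.
move=> LX cg mdm v0 XX; have Lg := L2_continuous cg; have [Ldm _] := mdm.
have e0 n : 0 < 2^-1 ^+ n :> R by rewrite exprn_gt0.
have /choice[q qP] : forall n, exists q, step_on a b q /\
    forall x, x \in `]a, b] -> `|step_fun q x - g x| <= 2^-1 ^+ n.
  by move=> n; have [q qab qg] := step_approx ab cg (e0 n); exists q.
have qab n : step_on a b (q n) by have [] := qP n.
have sqr_bound (x y : R) : `|x| <= y -> x ^+ 2 <= y ^+ 2.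
  move=> xy; rewrite -real_normK ?num_real// ler_sqr ?nnegrE//.
  exact: le_trans xy.
have sqr_half n : (2^-1 ^+ n) ^+ 2 = (4 ^+ n)^-1 :> R.
  by rewrite -exprM mulnC exprM -exprVn; congr (_ ^+ n); field.
have LSF n := L2_step a b (q n).
have qg : L2cvg (@lebesgue_measure R) `[a, b] (fun n => step_fun (q n)) g.
  rewrite /L2cvg; apply: (@squeeze_cvgr _ _ _ _ (cst 0) (fun n => (b - a) * 4^-1 ^+ n)).
  - apply: nearW => n; rewrite ip_ge0//= mulrC.
    apply: ip_le_bound => //; first exact: L2B.
    by move=> x xab; rewrite exprVn -sqr_half; apply: sqr_bound; have [_] := qP n; apply.
  - exact: cvg_cst.
  - have : (b - a) * 4^-1 ^+ n @[n --> \oo] --> (b - a) * 0.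
      apply: cvgMr; apply: cvg_expr.
      by rewrite ger0_norm ?invr_ge0// invf_lt1// ltr1n.
    by rewrite mulr0.
have LSI n := L2_step_integral LX (qab n).
have SIK n k : (n <= k)%N ->
  ipP (step_integral (q k) X - step_integral (q n) X)
      (step_integral (q k) X - step_integral (q n) X) <=
  ((v + ipL dm dm) * (4 * (b - a))) / 4 ^+ n.
  move=> nk; pose r := q k ++ step_scale (-1) (q n).
  have rab : step_on a b r by apply: step_on_cat => //; exact: step_on_scale.
  have -> : step_integral (q k) X - step_integral (q n) X = step_integral r X.
    by rewrite step_integral_cat step_integral_scale scaleN1r.
  rewrite (ip_step_integrals LX LX rab rab mdm mdm XX).
  have rE : step_fun r = step_fun (q k) - step_fun (q n).
    by rewrite step_fun_cat step_fun_scale scaleN1r.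
  have Lr : L2L (step_fun r) by exact: L2_step.
  have r_le : ipL (step_fun r) (step_fun r) <= (4 * (b - a)) / 4 ^+ n.
    rewrite mulrAC; apply: ip_le_bound => // x xab.
    have -> : 4 / 4 ^+ n = (2 * 2^-1 ^+ n) ^+ 2 :> R.
      by rewrite exprMn sqr_half; congr (_ * _); ring.
    apply: sqr_bound; have [_ /(_ x xab) qn] := qP n; have [_ /(_ x xab) qk] := qP k.
    have -> : step_fun r x = (step_fun (q k) x - g x) - (step_fun (q n) x - g x).
      by rewrite rE !fctE; ring.
    apply: (le_trans (ler_normB _ _)); rewrite mulrDl mul1r lerD//.
    by apply: (le_trans qk); apply: ler_wiXn2l => //; rewrite invf_le1// ler1n.
  have CS := ip_CauchySchwarz mI Lr Ldm.
  rewrite -expr2; apply: (@le_trans _ _ ((v + ipL dm dm) * ipL (step_fun r) (step_fun r))).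
    by rewrite mulrDl lerD2l mulrC.
  by rewrite -mulrA ler_wpM2l// addr_ge0// ip_ge0.
have [I LI qI] := L2_complete LSI SIK.
by exists I; apply/wiener_integralP => //; split=> //; exists q.
Qed.

End wiener.

(** * Moments of the observed process *)

Section independence.
Context d (T : measurableType d) (R : realType) (P : probability T R).

(** The joint law of X and Y agrees with the product law on rectangles, hence
    everywhere, and Fubini's theorem factors the expectation of the product. *)
Lemma ip_independent (X Y : {RV P >-> R}) :
  L2 P setT X -> L2 P setT Y ->
  (forall A B : set R, measurable A -> measurable B ->
     P (X @^-1` A `&` Y @^-1` B) = (P (X @^-1` A) * P (Y @^-1` B))%E) ->
  ip P setT X Y = ip P setT X 1 * ip P setT Y 1.
Proof.
move=> LX LY XY.
have mXY : measurable_fun setT (fun w => (X w, Y w)) by exact: measurable_fun_pair.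
pose XYm : {RV P >-> (R * R)%type} := mfun_Sub (mem_set mXY).
pose f (z : R * R) := (z.1 * z.2)%:E.
have mf : measurable_fun setT f.
  by apply/measurable_EFinP; apply: measurable_funM; [exact: measurable_fst|exact: measurable_snd].
have if_ : P.-integrable setT (f \o XYm) by exact: L2_integrable_mul.
have prodE : forall Z : set (R * R), measurable Z ->
    (distribution P X \x distribution P Y)%E Z = distribution P XYm Z.
  by apply: product_measure_unique => A B mA mB; exact: XY.
have intE (g : R * R -> \bar R) :
    (\int[distribution P X \x distribution P Y]_z g z = \int[distribution P XYm]_z g z)%E.
  by apply: eq_measure_integral => Z mZ _; exact: prodE.
have ifp : (distribution P X \x distribution P Y)%E.-integrable setT f.
  apply/integrableP; split=> //; rewrite intE.
  by have /integrableP[] := integrable_pushforward mXY mf if_ measurableT.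
have L1 := @L2_1 _ _ _ P.
have iE (Z : {RV P >-> R}) : L2 P setT Z ->
    (distribution P Z).-integrable setT (fun y : R => y%:E) /\
    (\int[distribution P Z]_y y%:E)%E = (ip P setT Z 1)%:E.
  move=> LZ; have iZ : P.-integrable setT (EFin \o Z).
    have := L2_integrable_mul measurableT LZ L1.
    by under eq_fun do rewrite mulr1.
  have mE : measurable_fun setT (fun y : R => y%:E) by exact/measurable_EFinP.
  split; first exact: (integrable_pushforward (measurable_funPT Z) mE iZ measurableT).
  by rewrite integral_distribution// -ip_E1// unlock.
have [iXd iX] := iE _ LX; have [iYd iY] := iE _ LY.
apply: EFin_inj; rewrite -ip_E// unlock.
rewrite -[LHS]/(\int[P]_x (f \o XYm) x)%E -integral_distribution// -intE.
rewrite -integral12_prod_meas1//.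
under eq_integral => x _.
  rewrite /fubini_F/f/=; under eq_integral do rewrite EFinM.
  rewrite integralZl// iY.
  over.
by rewrite integralZr//= iX -EFinM.
Qed.

End independence.

Section regression.
Context d (T : measurableType d) (R : realType) (P : probability T R).
Variables (a b : R).

Notation ipP := (ip P setT).
Notation L2P := (L2 P setT).

Let mT : measurable [set: T] := measurableT.
Let L1 : L2P 1 := @L2_1 _ _ _ P.

Lemma brownian_L2 (X : R -> {RV P >-> R}) :
  brownian_motion_on a b X -> L2_process P a b (fun t => X t).
Proof.
move=> [_ _ XX _] t tab; split; first exact: measurable_funPT.
by have := XX _ _ tab tab; rewrite unlock => ->; rewrite ltry.
Qed.

Lemma brownian_cov (X : R -> {RV P >-> R}) s t : brownian_motion_on a b X ->
  s \in `[a, b] -> t \in `[a, b] -> ipP (X s) (X t) = Num.min s t.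
Proof.
move=> BX sab tab; have LX := brownian_L2 BX; have [_ _ XX _] := BX.
by apply: EFin_inj; rewrite -ip_E ?XX//; exact: LX.
Qed.

Lemma brownian_mean (X : R -> {RV P >-> R}) t : brownian_motion_on a b X ->
  t \in `[a, b] -> ipP (X t) 1 = 0.
Proof.
move=> BX tab; have LX := brownian_L2 BX; have [_ X0 _ _] := BX.
by apply: EFin_inj; rewrite -ip_E1 ?X0//; exact: LX.
Qed.

Lemma independent_processes_cov (X Y : R -> {RV P >-> R}) s t :
  brownian_motion_on a b X -> brownian_motion_on a b Y ->
  independent_processes_on a b X Y -> s \in `[a, b] -> t \in `[a, b] ->
  ipP (X s) (Y t) = 0.
Proof.
move=> BX BY XY sab tab.
rewrite ip_independent.
- by rewrite (brownian_mean BX sab) mul0r.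
- exact: (brownian_L2 BX).
- exact: (brownian_L2 BY).
move=> A B mA mB; apply: XY; apply: sub_sigma_algebra.
  by exists s; split=> //; exists A.
by exists t; split=> //; exists B.
Qed.

Variables (p : nat) (F : R -> 'M[R]_(p, 2)) (S : 'M[R]_2).
Variables (eps : 'I_2 -> R -> {RV P >-> R}).
Hypothesis eps_brownian : forall i, brownian_motion_on a b (eps i).
Hypothesis eps_indep : independent_processes_on a b (eps 0) (eps 1).

Lemma eps_cov k l s t : s \in `[a, b] -> t \in `[a, b] ->
  ipP (eps k s) (eps l t) = (k == l)%:R * Num.min s t.
Proof.
have eps01 u v : u \in `[a, b] -> v \in `[a, b] -> ipP (eps 0 u) (eps 1 v) = 0.
  exact: independent_processes_cov.
move=> sab tab; have [->|kl] := eqVneq k l.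
  by rewrite mul1r; exact: brownian_cov.
rewrite mul0r; case: (unliftP 0 k) kl => [k' ->|->]; rewrite ?ord1.
  case: (unliftP 0 l) => [l' ->|-> _]; rewrite ?ord1 ?eqxx//.
  by rewrite ipC (_ : lift 0 0 = 1) ?eps01//; exact: val_inj.
case: (unliftP 0 l) => [l' ->|->]; rewrite ?eqxx// ord1 => _.
by rewrite (_ : lift 0 0 = 1) ?eps01//; exact: val_inj.
Qed.

Notation Y := (regression_process F S eps).
Notation mean theta j t := (((F t)^T *m theta) j 0).

Definition noise j t : T -> R := \sum_k S j k *: (eps k t : T -> R).

Lemma regressionE theta j t :
  (fun w => Y theta t w j 0) = mean theta j t *: (1 : T -> R) + noise j t.
Proof.
apply/funext => w; rewrite /regression_process /noise !mxE fctE fct_sumE; congr (_ + _).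
  by rewrite -[RHS]/(_ * 1) mulr1.
by apply: eq_bigr => k _; rewrite mxE.
Qed.

Lemma L2_noise j t : t \in `[a, b] -> L2P (noise j t).
Proof.
move=> tab; apply: L2_sum => // k _; apply: L2Z => //.
exact: (brownian_L2 (eps_brownian k)).
Qed.

Lemma regression_L2 theta j : L2_process P a b (fun t w => Y theta t w j 0).
Proof.
move=> t tab; rewrite regressionE; apply: L2D => //; first exact: L2Z.
exact: L2_noise.
Qed.

Lemma noise_mean j t : t \in `[a, b] ->
  ipP (noise j t) 1 = 0.
Proof.
move=> tab; have Le k : L2P (eps k t) by exact: (brownian_L2 (eps_brownian k)).
rewrite ip_suml//; last by move=> k _; exact: L2Z.
by rewrite big1// => k _; rewrite ipZl// brownian_mean// mulr0.
Qed.

Lemma noise_cov j l s t : s \in `[a, b] -> t \in `[a, b] ->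
  ipP (noise j s) (noise l t) =
  (S *m S^T) j l * Num.min s t.
Proof.
move=> sab tab; have Les k : L2P (eps k s) by exact: (brownian_L2 (eps_brownian k)).
have Let k : L2P (eps k t) by exact: (brownian_L2 (eps_brownian k)).
rewrite ip_suml//; [|by move=> k _; exact: L2Z|exact: L2_noise].
rewrite mxE mulr_suml; apply: eq_bigr => k _.
rewrite ip_sumr//; [|by move=> k' _; exact: L2Z|exact: L2Z].
have covZ i : ipP (S j k *: (eps k s : T -> R)) (S l i *: (eps i t : T -> R)) =
    S j k * (S l i * ((k == i)%:R * Num.min s t)).
  by rewrite ipZl//; [rewrite ipZr// eps_cov|exact: L2Z].
under eq_bigr do rewrite covZ.
rewrite (bigD1 k)//= big1 => [|i ik]; first by rewrite eqxx mulr1n mxE; ring.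
by rewrite eq_sym (negbTE ik) mul0r !mulr0.
Qed.

Lemma regression_mean theta j t : t \in `[a, b] ->
  ipP (fun w => Y theta t w j 0) 1 = mean theta j t.
Proof.
move=> tab; rewrite regressionE ipDl//; [|exact: L2Z|exact: L2_noise].
by rewrite noise_mean// addr0 ipZl// ip_11 mulr1.
Qed.

Lemma regression_cov theta j l s t : s \in `[a, b] -> t \in `[a, b] ->
  ipP (fun w => Y theta s w j 0) (fun w => Y theta t w l 0) =
  (S *m S^T) j l * Num.min s t + mean theta j s * mean theta l t.
Proof.
move=> sab tab; have Ls := L2_noise j sab; have Lt := L2_noise l tab.
rewrite !regressionE ipDl// ?ipDr// ?noise_cov//; try exact: L2Z; last first.
  by apply: L2D => //; exact: L2Z.
have Ls' := L2Z mT (mean theta j s) L1; have Lt' := L2Z mT (mean theta l t) L1.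
rewrite !ipZl// !ipZr// [ipP 1 (noise l t)]ipC !noise_mean// ip_11.
by ring.
Qed.

End regression.

(** * Linear functionals of the trajectory *)

Section affine_functionals.
Context d (T : measurableType d) (R : realType) (P : probability T R).
Variables (a b : R).
Hypothesis ab : a <= b.
Implicit Types (X : R -> T -> R) (m dm g : R -> R).

Notation ipL := (ip (@lebesgue_measure R) `[a, b]).
Notation L2L := (L2 (@lebesgue_measure R) `[a, b]).
Notation ipP := (ip P setT).
Notation L2P := (L2 P setT).
Notation L2_process := (L2_process P a b).
Notation primitive_on := (primitive_on a b).

Let mT : measurable [set: T] := measurableT.
Let L1 : L2P 1 := @L2_1 _ _ _ P.
Let aab : a \in `[a, b]. Proof. by rewrite in_itv/= lexx. Qed.

Lemma L2_functional g X (I : T -> R) c : L2_process X ->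
  wiener_integral P a b g X I -> L2P (I + c *: X a).
Proof.
by move=> LX /L2_wiener LI; apply: L2D => //; apply: L2Z => //; exact: LX.
Qed.

Lemma functional_mean g X I m dm c : L2_process X -> L2L g -> primitive_on m dm ->
  (forall t, t \in `[a, b] -> ipP (X t) 1 = m t) ->
  wiener_integral P a b g X I ->
  ipP (I + c *: X a) 1 = ipL g dm + c * m a.
Proof.
move=> LX Lg mdm X1 WI; have LI := L2_wiener WI; have LXa := LX _ aab.
rewrite ipDl//; last exact: L2Z.
rewrite ipZl// X1// (ip_wiener (k := 0) (l := 1) LX Lg L1 mdm _ WI) ?mul1r//.
by move=> t tab; rewrite add0r mul1r X1.
Qed.

(** Since min(t, a) = a on [a, b], the covariance of X' at time a with X at time t
    does not depend on t, so integrals over [a, b] are uncorrelated with initial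
    values and no mixed covariance appears. *)
Lemma functional_cov g g' X X' I I' m dm m' dm' v c c' :
  L2_process X -> L2_process X' -> L2L g -> L2L g' ->
  primitive_on m dm -> primitive_on m' dm' ->
  (forall s t, s \in `[a, b] -> t \in `[a, b] ->
     ipP (X s) (X' t) = v * Num.min s t + m s * m' t) ->
  wiener_integral P a b g X I -> wiener_integral P a b g' X' I' ->
  ipP (I + c *: X a) (I' + c' *: X' a) =
    v * (ipL g g' + a * c * c') + (ipL g dm + c * m a) * (ipL g' dm' + c' * m' a).
Proof.
move=> LX LX' Lg Lg' mdm mdm' XX' WI WI'.
have LI := L2_wiener WI; have LI' := L2_wiener WI'.
have LXa := LX _ aab; have LXa' := LX' _ aab.
have cXa := L2Z mT c LXa; have cXa' := L2Z mT c' LXa'.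
have mina t : t \in `[a, b] -> Num.min t a = a /\ Num.min a t = a.
  by rewrite in_itv/= => /andP[at_ _]; rewrite (min_idPr at_) (min_idPl at_).
have IXa : ipP I (X' a) = m' a * ipL g dm.
  apply: (ip_wiener (k := v * a) LX Lg LXa' mdm _ WI) => t tab.
  by rewrite XX'// (mina _ tab).1 [m' a * _]mulrC.
have IXa' : ipP I' (X a) = m a * ipL g' dm'.
  apply: (ip_wiener (k := v * a) LX' Lg' LXa mdm' _ WI') => t tab.
  by rewrite ipC XX'// (mina _ tab).2.
rewrite ipDl//; last exact: L2D.
rewrite !ipDr// !ipZr// !ipZl// [ipP (X a) I']ipC IXa IXa' XX'// (mina _ aab).1.
by rewrite (ip_wieners LX LX' Lg Lg' mdm mdm' XX' WI WI'); ring.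
Qed.

Lemma primitive_on_sum n (c : 'I_n -> R) (m dm : 'I_n -> R -> R) :
  (forall k, primitive_on (m k) (dm k)) ->
  primitive_on (\sum_k c k *: m k) (\sum_k c k *: dm k).
Proof.
move=> mdm; have mI : measurable ([set` `[a, b]] : set (measurableTypeR R)).
  exact: measurable_itv.
have Ldm k : L2L (dm k) by have [] := mdm k.
split; first by apply: L2_sum => // k _; exact: L2Z.
move=> s t as_ st tb; have Li : L2L (\1_(`]s, t])) by apply: L2_indic; exact: measurable_itv.
rewrite ip_sumr//; last by move=> k _; exact: L2Z.
rewrite !fct_sumE -sumrB; apply: eq_bigr => k _.
by rewrite ipZr//; have [_ ->//] := mdm k; rewrite mulrBr.
Qed.

Lemma C1_primitive_on m dm : derivative_on a b m dm ->
  {within `[a, b], continuous dm} -> primitive_on m dm.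
Proof.
move=> dP cdm; split; first exact: L2_continuous.
by move=> s t as_ st tb; exact: FTC_on.
Qed.

End affine_functionals.

Section sigma.
Context (R : realType).
Variables (s1 s2 rho : R).
Hypotheses (s1_gt0 : 0 < s1) (s2_gt0 : 0 < s2) (rho_gtN1 : -1 < rho) (rho_lt1 : rho < 1).

Lemma Sigma_mx_sym : (Sigma_mx s1 s2 rho)^T = Sigma_mx s1 s2 rho.
Proof.
apply/matrixP => i j; rewrite !mxE eq_sym.
by case: eqP => // ->.
Qed.

Lemma Sigma_mx_unit : Sigma_mx s1 s2 rho \in unitmx.
Proof.
rewrite unitmxE unitfE (expand_det_row _ 0) !big_ord_recl big_ord0.
rewrite /cofactor !det_mx11 !mxE/= gt_eqF//.
rewrite (_ : _ + _ = (s1 * s2) ^+ 2 * ((1 - rho) * (1 + rho))); last first.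
  by rewrite expr0 expr1; ring.
have rho1 : 0 < 1 - rho by rewrite subr_gt0.
have rho2 : 0 < 1 + rho by rewrite -ltrBlDl sub0r.
by rewrite mulr_gt0 ?exprn_gt0 ?mulr_gt0.
Qed.

End sigma.

(** * Best linear unbiased estimation *)

Section estimators.
Context d (T : measurableType d) (R : realType) (P : probability T R).
Variables (p : nat) (a b : R) (F dF : R -> 'M[R]_(p, 2)) (Sg S : 'M[R]_2).
Variable eps : 'I_2 -> R -> {RV P >-> R}.
Hypotheses (a_gt0 : 0 < a) (ab : a <= b) (F_C1 : C1_on a b F dF).
Hypotheses (Sg_sym : Sg^T = Sg) (Sg_unit : Sg \in unitmx) (S_sqrt : is_sqrt_mx Sg S).
Hypothesis eps_brownian : forall i, brownian_motion_on a b (eps i).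
Hypothesis eps_indep : independent_processes_on a b (eps 0) (eps 1).

Notation ipL := (ip (@lebesgue_measure R) `[a, b]).
Notation L2L := (L2 (@lebesgue_measure R) `[a, b]).
Notation ipP := (ip P setT).
Notation L2P := (L2 P setT).
Notation Y := (regression_process F S eps).
Notation M := (info_mx a b F dF Sg).
Notation mean theta j := (fun t => ((F t)^T *m theta) j 0).
Notation dmean theta j := (fun t => ((dF t)^T *m theta) j 0).
Notation coord Z i := (fun w => (Z w : 'cV[R]_p) i 0).

Let mT : measurable [set: T] := measurableT.
Let L1 : L2P 1 := @L2_1 _ _ _ P.
Let mI : measurable ([set` `[a, b]] : set (measurableTypeR R)) := measurable_itv _.

Implicit Types (G : R -> 'M[R]_(p, 2)) (C : 'M[R]_(p, 2)) (theta : 'cV[R]_p).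

Definition L2_mx G : Prop := forall i j, L2L (fun t => G t i j).

Definition estimator_at theta G C (Z : T -> 'cV[R]_p) : Prop :=
  exists2 I, wiener_integral_mx P a b G (Y theta) I
    & forall w, Z w = I w + C *m Y theta a w.

(** The matrix int G dF^T + C F(a)^T, by which the parameter is multiplied in the
    mean of the estimator with coefficients G and C. *)
Definition bias_mx G C : 'M[R]_p :=
  \matrix_(i, k) \sum_j (ipL (fun t => G t i j) (fun t => dF t k j) + C i j * F a k j).

(** The matrix int G Sigma G'^T + a C Sigma C'^T, which is the cross-covariance of the
    estimators with coefficients (G, C) and (G', C'): see [estimator_cov]. *)
Definition cross_mx G C G' C' : 'M[R]_p :=
  \matrix_(i, k) \sum_j \sum_l
    Sg j l * (ipL (fun t => G t i j) (fun t => G' t k l) + a * C i j * C' k l).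

Let LdF : L2_mx dF.
Proof. by move=> i j; apply: L2_continuous; have [] := F_C1 i j. Qed.

Let SST : S *m S^T = Sg.
Proof. by have [[-> _] ->] := S_sqrt. Qed.

Lemma dmeanE theta j :
  dmean theta j = \sum_k theta k 0 *: (fun t => dF t k j).
Proof.
apply/funext => t; rewrite mxE fct_sumE; apply: eq_bigr => k _.
by rewrite !mxE mulrC.
Qed.

Lemma mean_primitive theta j : primitive_on a b (mean theta j) (dmean theta j).
Proof.
rewrite dmeanE (_ : mean theta j = \sum_k theta k 0 *: (fun t => F t k j)).
  apply: primitive_on_sum => k.
  by have [dP cdF] := F_C1 k j; exact: C1_primitive_on.
apply/funext => t; rewrite mxE fct_sumE; apply: eq_bigr => k _.
by rewrite !mxE mulrC.
Qed.

Lemma bias_mxE G C theta i : L2_mx G ->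
  (bias_mx G C *m theta) i 0 =
  \sum_j (ipL (fun t => G t i j) (dmean theta j) + C i j * mean theta j a).
Proof.
move=> LG; rewrite mxE; under eq_bigr do rewrite mxE mulr_suml.
rewrite exchange_big/=; apply: eq_bigr => j _.
under eq_bigr do rewrite mulrDl.
rewrite big_split/=; congr (_ + _); last first.
  rewrite mxE mulr_sumr; apply: eq_bigr => k _.
  by rewrite mxE mulrA.
rewrite dmeanE ip_sumr//; last by move=> k _; apply: L2Z => //; exact: LdF.
by apply: eq_bigr => k _; rewrite (ipZr mI _ (LdF k j) (LG i j)) mulrC.
Qed.

Lemma estimator_coord theta G C Z : L2_mx G -> estimator_at theta G C Z ->
  exists2 J : 'I_p -> 'I_2 -> T -> R,
    (forall i j, wiener_integral P a b (fun t => G t i j)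
                   (fun t w => Y theta t w j 0) (J i j)) &
    forall i, coord Z i =
      \sum_j (J i j + C i j *: (fun w => Y theta a w j 0)).
Proof.
move=> LG [I [J [WJ IJ]] ZI]; exists J => // i; apply/funext => w.
rewrite ZI mxE IJ mxE -big_split/= fct_sumE.
by apply: eq_bigr => j _.
Qed.

Lemma L2_estimator theta G C Z i : L2_mx G -> estimator_at theta G C Z ->
  L2P (coord Z i).
Proof.
move=> LG /(estimator_coord LG)[J WJ ->]; apply: L2_sum => // j _.
exact: (L2_functional ab _ (regression_L2 F S eps_brownian theta j) (WJ i j)).
Qed.

Lemma estimator_mean theta G C Z i : L2_mx G -> estimator_at theta G C Z ->
  ipP (coord Z i) 1 = (bias_mx G C *m theta) i 0.
Proof.
move=> LG /(estimator_coord LG)[J WJ ->].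
have LY j := regression_L2 F S eps_brownian theta j.
rewrite ip_suml//; last by move=> j _; exact: (L2_functional ab _ (LY j) (WJ i j)).
rewrite bias_mxE//; apply: eq_bigr => j _.
rewrite (functional_mean ab _ (LY j) (LG i j) (mean_primitive theta j) _ (WJ i j))//.
by move=> t tab; rewrite (regression_mean F S eps_brownian).
Qed.

Lemma estimator_cov theta G C Z G' C' Z' i k :
  L2_mx G -> L2_mx G' -> estimator_at theta G C Z -> estimator_at theta G' C' Z' ->
  ipP (coord Z i) (coord Z' k) = cross_mx G C G' C' i k +
    (bias_mx G C *m theta) i 0 * (bias_mx G' C' *m theta) k 0.
Proof.
move=> LG LG' /(estimator_coord LG)[J WJ ->] /(estimator_coord LG')[J' WJ' ->].
have LY j := regression_L2 F S eps_brownian theta j.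
have LJ j := L2_functional ab (C i j) (LY j) (WJ i j).
have LJ' j := L2_functional ab (C' k j) (LY j) (WJ' k j).
rewrite ip_suml//; last by apply: L2_sum.
rewrite !bias_mxE// mxE mulr_suml -big_split/=; apply: eq_bigr => j _.
rewrite ip_sumr// mulr_sumr -big_split/=; apply: eq_bigr => l _.
rewrite (functional_cov ab _ _ (LY j) (LY l) (LG i j) (LG' k l)
  (mean_primitive theta j) (mean_primitive theta l) _ (WJ i j) (WJ' k l) (v := Sg j l))//.
by move=> s t sab tab; rewrite (regression_cov F S eps_brownian)// SST.
Qed.

Lemma cov_mx_estimator theta G C Z : L2_mx G -> estimator_at theta G C Z ->
  cov_mx P Z = cross_mx G C G C.
Proof.
move=> LG EZ; apply/matrixP => i k; rewrite [LHS]mxE.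
have LZ l := L2_estimator l LG EZ.
rewrite covarianceE; last 3 first.
- apply: Lfun_subset12; first exact: fin_num_measure.
  by apply/Lfun2P; exact: LZ.
- apply: Lfun_subset12; first exact: fin_num_measure.
  by apply/Lfun2P; exact: LZ.
- by apply: Lfun2_mul_Lfun1; apply/Lfun2P; exact: LZ.
rewrite [X in (X - _)%E](ip_E (LZ i) (LZ k)) !ip_E1// -EFinM -EFinB/= (estimator_cov i k LG LG EZ EZ).
by rewrite !(estimator_mean _ LG EZ) addrK.
Qed.

Definition opt_G t : 'M[R]_(p, 2) := invmx M *m (dF t *m invmx Sg).
Definition opt_C : 'M[R]_(p, 2) := invmx M *m (a^-1 *: (F a *m invmx Sg)).

Lemma mulmx_row_fun n (A : 'M[R]_(n, p)) (H : R -> 'M[R]_(p, 2)) i j :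
  (fun t => (A *m H t) i j) = \sum_k A i k *: (fun t => H t k j).
Proof. by apply/funext => t; rewrite mxE fct_sumE. Qed.

Lemma L2_mulmx (A : 'M[R]_p) G : L2_mx G -> L2_mx (fun t => A *m G t).
Proof.
move=> LG i j; rewrite mulmx_row_fun; apply: L2_sum => // k _.
by apply: L2Z => //; exact: LG.
Qed.

Lemma continuous_score i j :
  {within `[a, b], continuous (fun t => (dF t *m invmx Sg) i j)}.
Proof.
have cdF k : {within `[a, b], continuous (fun t => dF t i k * invmx Sg k j)}.
  by move=> x; apply: cvgM; [have [_] := F_C1 i k; exact|exact: cvg_cst].
rewrite (_ : (fun t => _) = fun t => dF t i 0 * invmx Sg 0 j +
    dF t i (lift 0 0) * invmx Sg (lift 0 0) j).
  by move=> x; apply: cvgD; exact: cdF.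
by apply/funext => t; rewrite mxE !big_ord_recl big_ord0 addr0.
Qed.

Lemma L2_score : L2_mx (fun t => dF t *m invmx Sg).
Proof. by move=> i j; apply: L2_continuous; exact: continuous_score. Qed.

Lemma L2_opt_G : L2_mx opt_G.
Proof. exact/L2_mulmx/L2_score. Qed.

Lemma bias_mx_mul A G C : L2_mx G ->
  bias_mx (fun t => A *m G t) (A *m C) = A *m bias_mx G C.
Proof.
move=> LG; apply/matrixP => i k; rewrite !mxE.
under [RHS]eq_bigr do rewrite mxE mulr_sumr.
rewrite [RHS]exchange_big/=; apply: eq_bigr => j _.
under [RHS]eq_bigr do rewrite mulrDr.
rewrite big_split/=; congr (_ + _); last first.
  by rewrite mxE mulr_suml; apply: eq_bigr => l _; rewrite mulrA.
rewrite mulmx_row_fun ip_suml//; last by move=> l _; apply: L2Z => //; exact: LG.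
by apply: eq_bigr => l _; rewrite (ipZl mI _ (LG l j) (LdF k j)).
Qed.

(** The estimator before multiplication by M^-1 has mean M theta, which is why the
    one after it is unbiased. *)
Lemma info_mx_bias :
  M = bias_mx (fun t => dF t *m invmx Sg) (a^-1 *: (F a *m invmx Sg)).
Proof.
apply/matrixP => i k; rewrite !mxE big_split/=; congr (_ + _); last first.
  by rewrite mulr_sumr; apply: eq_bigr => j _; rewrite !mxE mulrA.
rewrite !big_ord_recl !big_ord0 !addr0 /ip -RintegralD//; last 2 first.
- exact: (L2_integrable_mul mI (L2_score i _) (LdF k _)).
- exact: (L2_integrable_mul mI (L2_score i _) (LdF k _)).
apply: eq_Rintegral => t _; rewrite [in LHS]mxE !big_ord_recl big_ord0 addr0.
by rewrite [_^T _ k]mxE [_^T _ k]mxE.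
Qed.

Lemma info_mx_sym : M^T = M.
Proof.
have sym (A : 'M[R]_(p, 2)) : (A *m invmx Sg *m A^T)^T = A *m invmx Sg *m A^T.
  by rewrite !trmx_mul trmxK trmx_inv Sg_sym mulmxA.
apply/matrixP => i k; rewrite !mxE; congr (_ + _ * _).
  by apply: eq_Rintegral => t _; rewrite -[in RHS]sym [RHS]mxE.
have /matrixP/(_ i k) := sym (F a).
by rewrite [LHS]mxE !mxE.
Qed.

Hypothesis M_unit : M \in unitmx.

Lemma bias_mx_opt : bias_mx opt_G opt_C = 1%:M.
Proof.
have E := bias_mx_mul (invmx M) (a^-1 *: (F a *m invmx Sg)) L2_score.
by rewrite [LHS]E -info_mx_bias mulVmx.
Qed.

Let Sg_symE j l : Sg j l = Sg l j.
Proof. by rewrite -[in LHS]Sg_sym mxE. Qed.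

Lemma opt_Sg_G t k j : \sum_l Sg j l * opt_G t k l = (invmx M *m dF t) k j.
Proof.
rewrite -[in RHS](mulmxKV Sg_unit (dF t)) mulmxA -[RHS]/((opt_G t *m Sg) k j) mxE.
by apply: eq_bigr => l _; rewrite Sg_symE mulrC.
Qed.

Lemma opt_Sg_C k j : \sum_l Sg j l * (a * opt_C k l) = (invmx M *m F a) k j.
Proof.
rewrite -[in RHS](mulmxKV Sg_unit (F a)) mulmxA mxE.
apply: eq_bigr => l _; rewrite Sg_symE [LHS]mulrC; congr (_ * _).
by rewrite /opt_C -scalemxAr mxE mulrA divff ?mul1r// gt_eqF.
Qed.

(** The factor Sigma cancels against its inverse in [opt_G] and [opt_C], and what is
    left of the cross-covariance is the bias matrix. *)
Lemma cross_mx_opt G C : L2_mx G ->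
  cross_mx G C opt_G opt_C = bias_mx G C *m invmx M.
Proof.
move=> LG; apply/matrixP => i k; rewrite !mxE.
have symV r : invmx M r k = invmx M k r.
  by rewrite -[in LHS]info_mx_sym -trmx_inv mxE.
transitivity (\sum_j (ipL (fun t => G t i j) (fun t => (invmx M *m dF t) k j) +
    C i j * (invmx M *m F a) k j)).
  apply: eq_bigr => j _; rewrite -opt_Sg_C mulr_sumr.
  have -> : (fun t => (invmx M *m dF t) k j) = \sum_l Sg j l *: (fun t => opt_G t k l).
    by apply/funext => t; rewrite -opt_Sg_G fct_sumE.
  rewrite ip_sumr//; last by move=> l _; apply: L2Z => //; exact: L2_opt_G.
  rewrite -big_split/=; apply: eq_bigr => l _.
  by rewrite (ipZr mI _ (L2_opt_G k l) (LG i j)); ring.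
under [RHS]eq_bigr do rewrite mxE mulr_suml.
rewrite [RHS]exchange_big/=; apply: eq_bigr => j _.
under [RHS]eq_bigr do rewrite mulrDl.
rewrite big_split/=; congr (_ + _); last first.
  by rewrite mxE mulr_sumr; apply: eq_bigr => r _; rewrite symV; ring.
rewrite mulmx_row_fun ip_sumr//; last by move=> r _; apply: L2Z => //; exact: LdF.
by apply: eq_bigr => r _; rewrite (ipZr mI _ (LdF r j) (LG i j)) symV mulrC.
Qed.

(** The matrix M^-1 moves from the outside of the integral into the integrand
    by linearity of the Wiener integral. *)
Lemma theta_hat_estimator Z : is_theta_hat P a b F dF Sg Y Z ->
  forall theta, estimator_at theta opt_G opt_C (Z theta).
Proof.
move=> HZ theta; have [I [J [WJ IJ]] ZE] := HZ theta.
exists (fun w => invmx M *m I w).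
  exists (fun i j => \sum_k invmx M i k *: J k j); split.
    move=> i j; rewrite /opt_G mulmx_row_fun.
    apply: wiener_sum => //; first exact: (regression_L2 F S eps_brownian).
    by move=> k; exact: L2_score.
  move=> w i; rewrite mxE; under eq_bigr do rewrite IJ mulr_sumr.
  by rewrite exchange_big/=; apply: eq_bigr => j _; rewrite fct_sumE.
by move=> w; rewrite ZE mulmxDr /opt_C scalemxAl -!mulmxA.
Qed.

Lemma theta_hat_exists : exists Z, is_theta_hat P a b F dF Sg Y Z.
Proof.
have Jex theta i j : exists J, wiener_integral P a b
    (fun t => (dF t *m invmx Sg) i j) (fun t w => Y theta t w j 0) J.
  apply: (wiener_exists ab (regression_L2 F S eps_brownian theta j)
    (@continuous_score i j) (mean_primitive theta j) (v := Sg j j)).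
    by rewrite -SST mxE sumr_ge0// => k _; rewrite mxE -expr2 sqr_ge0.
  by move=> s t sab tab; rewrite (regression_cov F S eps_brownian)// SST.
pose J theta i j := projT1 (cid (Jex theta i j)).
exists (fun theta w => invmx M *m
  ((\col_i \sum_j J theta i j w) + a^-1 *: (F a *m invmx Sg *m Y theta a w))).
move=> theta; exists (fun w => \col_i \sum_j J theta i j w) => //.
exists (J theta); split; last by move=> w i; rewrite mxE.
by move=> i j; exact: (projT2 (cid (Jex theta i j))).
Qed.

(** Unbiasedness for all theta is tested on the canonical basis. *)
Lemma unbiased_bias_mx Z G C : L2_mx G ->
  (forall theta, estimator_at theta G C (Z theta)) ->
  unbiased P Z <-> bias_mx G C = 1%:M.
Proof.
move=> LG EZ; split=> [uZ|B1 theta i]; last first.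
  rewrite ip_E1; last exact: L2_estimator (EZ theta).
  by rewrite (estimator_mean _ LG (EZ theta)) B1 mul1mx.
apply/matrixP => i k; have := uZ (delta_mx k 0) i.
rewrite ip_E1; last exact: L2_estimator (EZ _).
by rewrite (estimator_mean _ LG (EZ _)) -colE => -[]; rewrite !mxE andbT.
Qed.

(** Both cross-covariances of Z' and Z0, and the covariance of Z0, are equal to M^-1
    by [cross_mx_opt]; in Cov(Z' - Z0) they add up to -M^-1. The difference has mean 0,
    so the inner products on the left are the entries of Cov(Z' - Z0). *)
Lemma ip_diff_opt theta Z0 Z' G C i k : L2_mx G -> bias_mx G C = 1%:M ->
  estimator_at theta opt_G opt_C Z0 -> estimator_at theta G C Z' ->
  ipP (coord Z' i - coord Z0 i) (coord Z' k - coord Z0 k) =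
  (cov_mx P Z' - invmx M) i k.
Proof.
move=> LG B1 E0 E'.
have L0 j := L2_estimator j L2_opt_G E0; have L' j := L2_estimator j LG E'.
have B0 := bias_mx_opt.
have cov_opt r s : ipP (coord Z' r) (coord Z0 s) =
    invmx M r s + theta r 0 * theta s 0.
  by rewrite (estimator_cov r s LG L2_opt_G E' E0) cross_mx_opt// B0 B1 !mul1mx.
rewrite ipBl//; last exact: L2B.
rewrite !ipBr// [ipP (coord Z0 i) (coord Z' k)]ipC !cov_opt.
rewrite (estimator_cov i k LG LG E' E') (estimator_cov i k L2_opt_G L2_opt_G E0 E0).
rewrite (cov_mx_estimator LG E') cross_mx_opt; last exact: L2_opt_G.
rewrite B0 B1 !mul1mx ![in RHS]mxE.
have -> : invmx M k i = invmx M i k by rewrite -[in LHS]info_mx_sym -trmx_inv mxE.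
by rewrite mxE; ring.
Qed.

Lemma cov_mx_theta_hat Z theta : is_theta_hat P a b F dF Sg Y Z ->
  cov_mx P (Z theta) = invmx M.
Proof.
move=> HZ; rewrite (cov_mx_estimator L2_opt_G (theta_hat_estimator HZ theta)).
by rewrite cross_mx_opt ?bias_mx_opt ?mul1mx//; exact: L2_opt_G.
Qed.

Lemma quadratic_form_sum (A : 'M[R]_p) (x : 'cV[R]_p) :
  (x^T *m A *m x) 0 0 = \sum_i \sum_k x i 0 * (x k 0 * A i k).
Proof.
rewrite mxE exchange_big/=; apply: eq_bigr => k _.
rewrite mxE mulr_suml; apply: eq_bigr => i _.
by rewrite mxE; ring.
Qed.

(** The quadratic form of Cov Z' - M^-1 at x is the second moment of
    x^T (Z' - Z). *)
Lemma theta_hat_BLUE Z : is_theta_hat P a b F dF Sg Y Z -> is_BLUE P a b Y Z.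
Proof.
move=> HZ; have EZ := theta_hat_estimator HZ; split.
- by exists opt_G, opt_C; split=> //; exact: L2_opt_G.
- by apply/(unbiased_bias_mx L2_opt_G EZ); exact: bias_mx_opt.
move=> Z' [G [C [LG EZ']]] /(unbiased_bias_mx LG EZ') B1 theta.
rewrite cov_mx_theta_hat//.
have ipD i k := ip_diff_opt i k LG B1 (EZ theta) (EZ' theta).
have LD i : L2P (coord (Z' theta) i - coord (Z theta) i).
  apply: L2B => //; first exact: L2_estimator (EZ' theta).
  exact: (L2_estimator _ L2_opt_G (EZ theta)).
split; first by apply/matrixP => i k; rewrite mxE -!ipD ipC.
move=> x; rewrite quadratic_form_sum.
have := ip_ge0 P setT (\sum_i x i 0 *: (coord (Z' theta) i - coord (Z theta) i)).
have LxD i : L2P (x i 0 *: (coord (Z' theta) i - coord (Z theta) i)).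
  exact: L2Z.
rewrite ip_suml//; last exact: L2_sum.
congr (0 <= _); apply: eq_bigr => i _.
rewrite ip_sumr//; apply: eq_bigr => k _.
by rewrite ipZl// ipZr// ipD.
Qed.

(** Optimality of Z', compared with Z, makes the diagonal entries of
    Cov Z' - M^-1 nonpositive. They are the second moments of the coordinates of
    Z' - Z, which therefore vanish almost surely. *)
Lemma BLUE_unique Z Z' : is_theta_hat P a b F dF Sg Y Z -> is_BLUE P a b Y Z' ->
  forall theta, {ae P, forall w, Z' theta w = Z theta w}.
Proof.
move=> HZ [[G [C [LG EZ']]] uZ' minZ'] theta; have EZ := theta_hat_estimator HZ.
have [linZ uZ _] := theta_hat_BLUE HZ.
have B1 : bias_mx G C = 1%:M by apply/(unbiased_bias_mx LG EZ').
have LD i : L2P (coord (Z' theta) i - coord (Z theta) i).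
  apply: L2B => //; first exact: L2_estimator (EZ' theta).
  exact: (L2_estimator _ L2_opt_G (EZ theta)).
have D0 i : ipP (coord (Z' theta) i - coord (Z theta) i)
    (coord (Z' theta) i - coord (Z theta) i) = 0.
  apply/eqP; rewrite eq_le ip_ge0 andbT.
  rewrite (ip_diff_opt i i LG B1 (EZ theta) (EZ' theta)).
  (* the quadratic form at the i-th basis vector is the i-th diagonal entry *)
  have [_ /(_ (delta_mx i 0))] := minZ' Z linZ uZ theta.
  rewrite cov_mx_theta_hat// trmx_delta -rowE -colE mxE mxE -[_ - invmx M]opprB.
  by rewrite [X in _ -> X <= _]mxE oppr_le0.
have ae0 i : {ae P, forall w, Z' theta w i 0 = Z theta w i 0}.
  have := ip_eq0_ae mT (LD i) (D0 i); apply: filterS => w /(_ I) /eqP.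
  by rewrite subr_eq0 => /eqP.
apply: filterS (filter_forall _ ae0) => w Zw.
by apply/colP => i; exact: Zw.
Qed.

End estimators.

Theorem theorem3p1 (R : realType) (d : measure_display) (T : measurableType d)
    (P : probability T R) (p : nat) (a b : R) (F dF : R -> 'M[R]_(p, 2))
    (s1 s2 rho : R) (S : 'M[R]_2) (eps : 'I_2 -> R -> {RV P >-> R})
    (a_gt0 : 0 < a) (a_lt_b : a < b)
    (F_C1 : C1_on a b F dF)
    (F_free : forall c : 'rV[R]_p,
       (forall t, t \in `[a, b] -> c *m F t = 0) -> c = 0)
    (s1_gt0 : 0 < s1) (s2_gt0 : 0 < s2) (rho_gtN1 : -1 < rho) (rho_lt1 : rho < 1)
    (S_sqrt : is_sqrt_mx (Sigma_mx s1 s2 rho) S)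
    (eps_brownian : forall i, brownian_motion_on a b (eps i))
    (eps_indep : independent_processes_on a b (eps 0) (eps 1))
    (M_unit : info_mx a b F dF (Sigma_mx s1 s2 rho) \in unitmx) :
  let Sigma := Sigma_mx s1 s2 rho in
  let M := info_mx a b F dF Sigma in
  let Y := regression_process F S eps in
  (exists Z, is_theta_hat P a b F dF Sigma Y Z) /\
  forall Z, is_theta_hat P a b F dF Sigma Y Z ->
    [/\ is_BLUE P a b Y Z,
        forall theta, cov_mx P (Z theta) = invmx M
      & forall Z', is_BLUE P a b Y Z' ->
          forall theta, {ae P, forall w, Z' theta w = Z theta w}].
Proof.
move=> Sigma M Y.
have Ss : Sigma^T = Sigma by exact: Sigma_mx_sym.
have Su : Sigma \in unitmx by exact: Sigma_mx_unit.
have ab := ltW a_lt_b.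
split; first exact: (theta_hat_exists ab F_C1 S_sqrt eps_brownian eps_indep).
move=> Z HZ; split.
- exact: (theta_hat_BLUE a_gt0 ab F_C1 Ss Su S_sqrt eps_brownian eps_indep M_unit HZ).
- move=> theta.
  exact: (cov_mx_theta_hat a_gt0 ab F_C1 Ss Su S_sqrt eps_brownian eps_indep M_unit theta HZ).
- move=> Z' HZ'.
  exact: (BLUE_unique a_gt0 ab F_C1 Ss Su S_sqrt eps_brownian eps_indep M_unit HZ HZ').
Qed.
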